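(* Let $d \geq 39$. Let $G$ be an infinite rooted tree of uniformly bounded degree each of whose vertices has at least $d$ offspring. Then for every $T \geq 429\, d^{-1}$, the random stirring model with parameter $T$ on $G$ contains infinite cycles almost surely.
   Context: The random stirring model on a graph $G$ is the process $(\sigma_t)_{t\ge 0}$ of permutations of $V(G)$ which starts at the identity at time $0$ and in which, independently for each edge $e\in E(G)$, the transposition of the two endpoints of $e$ is performed (composed) at each point of a rate-one Poisson process on $[0,\infty)$. The random stirring model with parameter $T$ is the random permutation $\sigma_T$. An infinite cycle is a cycle containing infinitely many vertices. The offspring of a vertex $v$ of a rooted tree are its neighbours farther from the root than $v$. *)

(* Defs.v *)
From HB Require Import structures.
From mathcomp Require Import all_boot all_order all_algebra.
From mathcomp Require Import all_classical all_reals all_analysis.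
Set Implicit Arguments. Unset Strict Implicit. Unset Printing Implicit Defensive.
Import Order.TTheory GRing.Theory Num.Theory.
Local Open Scope classical_set_scope.
Local Open Scope ring_scope.

(* ---------- Rooted trees ----------
   A rooted tree on the vertex type V is given by its root r and the parent
   map par : V -> V, with par r = r, par v <> v for v <> r, and every vertex
   reaching the root after finitely many parent steps.  Its edges are the
   pairs {w, par w} for w <> r; we index each edge by its child endpoint w. *)
Definition rooted_tree (V : Type) (r : V) (par : V -> V) : Prop :=
  par r = r /\ (forall v, v <> r -> par v <> v) /\
  (forall v, exists n, iter n par v = r).

Definition offspring (V : Type) (r : V) (par : V -> V) (v w : V) : Prop :=
  w <> r /\ par w = v.

Definition min_offspring (V : Type) (r : V) (par : V -> V) (d : nat) : Prop :=
  forall v, exists f : 'I_d -> V, injective f /\ forall i, offspring r par v (f i).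

(* uniformly bounded degree: the number of offspring (hence the degree,
   which is at most offspring + 1) is bounded by a uniform constant *)
Definition bounded_degree (V : Type) (r : V) (par : V -> V) : Prop :=
  exists D : nat, forall v (n : nat) (f : 'I_n -> V),
    injective f -> (forall i, offspring r par v (f i)) -> (n <= D)%N.

Definition incident (V : Type) (r : V) (par : V -> V) (x w : V) : Prop :=
  w <> r /\ (w = x \/ par w = x).

Definition crosses (V : Type) (r : V) (par : V -> V) (x w y : V) : Prop :=
  w <> r /\ ((w = x /\ y = par w) \/ (par w = x /\ y = w)).

(* ---------- Random stirring (graphical construction) ----------
   Given the ring times N w : set R of each edge w, the particle started at v
   jumps across an incident edge each time that edge rings.  stir r par N T v u
   says that the particle started at v is at u at time T: there is a finite
   sequence of jump times 0 = t_0 < t_1 < ... < t_k <= T and positions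
   v = x_0, ..., x_k = u such that t_(i+1) is a ring time of an edge joining
   x_i and x_(i+1), and no edge incident to x_i rings during (t_i, t_(i+1))
   (resp. (t_k, T] for i = k).  Almost surely this relation is the graph of
   the permutation sigma_T (up to inversion, which does not change cycles). *)
Definition stir (R : realType) (V : Type) (r : V) (par : V -> V)
    (N : V -> set R) (T : R) (v u : V) : Prop :=
  exists (k : nat) (ts : nat -> R) (xs : nat -> V),
    [/\ xs 0%N = v, xs k = u, ts 0%N = 0 & ts k <= T] /\
     (forall i, (i < k)%N -> ts i < ts i.+1) /\
     (forall i, (i < k)%N ->
        exists w, crosses r par (xs i) w (xs i.+1) /\ N w (ts i.+1)) /\
     (forall i w t, (i <= k)%N -> incident r par (xs i) w ->
        ts i < t -> ((i < k)%N -> t < ts i.+1) -> ((k <= i)%N -> t <= T) ->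
        ~ N w t).

Fixpoint iter_rel (V : Type) (S : V -> V -> Prop) (n : nat) (v u : V) : Prop :=
  match n with
  | 0%N => u = v
  | n.+1 => exists y, iter_rel S n v y /\ S y u
  end.

Definition has_infinite_cycle (V : Type) (S : V -> V -> Prop) : Prop :=
  exists v, ~ finite_set [set u | exists n, iter_rel S n v u].

Definition has_card (T : Type) (A : set T) (k : nat) : Prop :=
  exists f : 'I_k -> T, injective f /\ range f = A.

Definition poisson_prob (R : realType) (m : R) (k : nat) : R :=
  expR (- m) * m ^+ k / (k`!)%:R.

(* N : V -> Omega -> set R is a family, indexed by the edges w <> r, of
   independent rate-one Poisson processes on [0, oo): for any finite family
   of (edge, interval (a,b]) with 0 <= a <= b, the intervals attached to the
   same edge being disjoint, the numbers of points are jointly independent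
   Poisson(b - a) random variables (the event is required measurable). *)
Definition indep_poisson_family (R : realType) (dm : measure_display)
    (Omega : measurableType dm) (P : probability Omega R)
    (V : Type) (r : V) (N : V -> Omega -> set R) : Prop :=
  forall (n : nat) (es : 'I_n -> V) (a b : 'I_n -> R) (k : 'I_n -> nat),
    (forall i, es i <> r /\ 0 <= a i /\ a i <= b i) ->
    (forall i j, i != j -> es i = es j -> b i <= a j \/ b j <= a i) ->
    let E := [set om | forall i,
                has_card (N (es i) om `&` [set t | a i < t /\ t <= b i]) (k i)] in
    measurable E /\
    P E = ((\prod_(i < n) poisson_prob (b i - a i) (k i))%R)%:E.

(* Main.v *)
Require Import Defs.
From HB Require Import structures.
From mathcomp Require Import all_boot all_order all_algebra.
From mathcomp Require Import ring lra zify.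
Set Implicit Arguments. Unset Strict Implicit. Unset Printing Implicit Defensive.
Import Order.TTheory GRing.Theory Num.Theory.
Local Open Scope ring_scope.

(* Follow a particle upwards on the pole {v} x [0, T], cyclically in time, and
   let it cross every bar (ring of an edge) that it meets: it visits infinitely
   many vertices iff its starting vertex lies on an infinite cycle. Suppose it
   has just entered a vertex v from its parent. With probability about 1 - 1/d
   it moves on to a child before meeting another bar to the parent. Such a first
   excursion to a child w may come back, but, unless the edge to w rings in the
   last 3/d units of time before the particle would have gone once round the
   pole of v (probability 3/d), enough fresh time is then left at v for the
   particle to enter, most likely, a second child. So if q bounds the
   probability of returning from a child within n steps, returning from v
   within n + 1 steps has probability at most
     1/d + 3/d + q (e^-3 + 2/d + q)
   up to small errors, and q = 1/2 is preserved by this recursion for d >= 39.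
   The point where a fresh bar of w must be shown to be no likelier after the
   return of w is handled by monotonicity: deleting an unused bar above w does
   not change the excursion.

   Time is cut into K + 1 slots and only the bits telling which edges ring in
   which slots are kept; they are independent, and as K grows the slot walk
   agrees with the true one on any given finite set of bars, so a Fatou argument
   transfers the bound 1/2. Applied to the 2^m disjoint subtrees of a binary subtree of depth
   m, it shows that all cycles are finite with probability at most 2^-(2^m). *)

(** * Bernoulli bits *)

Section BernoulliCube.
Variables (R : realFieldType) (I : finType) (p : R).
Hypotheses (p_ge0 : 0 <= p) (p_le1 : p <= 1).
Local Notation env := {ffun I -> bool}.

Definition bern (x : bool) : R := if x then p else 1 - p.
Definition cube_wt (a : env) : R := \prod_i bern (a i).
Definition Pr (A : env -> bool) : R := \sum_(a | A a) cube_wt a.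

Definition depon (J : I -> bool) (A : env -> bool) :=
  forall a b : env, (forall i, J i -> a i = b i) -> A a = A b.

Lemma bern_ge0 x : 0 <= bern x.
Proof. by case: x => //=; rewrite subr_ge0. Qed.

Lemma cube_wt_ge0 a : 0 <= cube_wt a.
Proof. by apply: prodr_ge0 => i _; apply: bern_ge0. Qed.

Lemma Pr_ge0 A : 0 <= Pr A.
Proof. by apply: sumr_ge0 => a _; apply: cube_wt_ge0. Qed.

Lemma eq_Pr (A B : env -> bool) : A =1 B -> Pr A = Pr B.
Proof. by move=> AB; apply: eq_bigl => a; rewrite AB. Qed.

Lemma PrE A : Pr A = \sum_a (A a)%:R * cube_wt a.
Proof.
rewrite /Pr big_mkcond; apply: eq_bigr => a _.
by case: (A a); rewrite (mul1r, mul0r).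
Qed.

Lemma le_Pr (A B : env -> bool) : (forall a, A a -> B a) -> Pr A <= Pr B.
Proof.
move=> AB; rewrite !PrE; apply: ler_sum => a _; apply: ler_wpM2r.
  exact: cube_wt_ge0.
by rewrite ler_nat; case: (A a) (AB a) => // ->.
Qed.

Lemma Pr_forall (F : I -> bool -> bool) :
  Pr (fun a => [forall i, F i (a i)]) = \prod_i \sum_(x | F i x) bern x.
Proof.
rewrite bigA_distr_big_dep; apply: eq_bigl => a.
by apply/forallP/familyP => Ha i; exact: Ha.
Qed.

Lemma sum_bern : \sum_x bern x = 1.
Proof. by rewrite big_bool /= addrC subrK. Qed.

Lemma Pr_true : Pr (fun _ => true) = 1.
Proof.
rewrite -[RHS](_ : \prod_(i : I) \sum_(x | true) bern x = 1).
  by rewrite -Pr_forall; apply: eq_Pr => a; symmetry; apply/forallP.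
by apply: big1 => i _; rewrite sum_bern.
Qed.

Lemma Pr_le1 A : Pr A <= 1.
Proof. by rewrite -Pr_true; apply: le_Pr. Qed.

Lemma Pr_zero (Z : I -> bool) :
  Pr (fun a => [forall i, Z i ==> ~~ a i]) = (1 - p) ^+ #|[pred i | Z i]|.
Proof.
rewrite (Pr_forall (fun i x => Z i ==> ~~ x)) (bigID [pred i | Z i]) /=.
rewrite [X in _ * X]big1 ?mulr1; last first.
  by move=> i /negbTE ->; rewrite sum_bern.
rewrite -prodr_const; apply: eq_big => // i Zi.
by rewrite big_mkcond big_bool /= Zi /= add0r.
Qed.

Lemma Pr_bit i : Pr (fun a => a i) = p.
Proof.
rewrite -[RHS](_ : \prod_j \sum_(x | (j == i) ==> x) bern x = p).
  rewrite -Pr_forall; apply: eq_Pr => a.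
  apply/idP/forallP => [ai j|/(_ i)]; last by rewrite eqxx.
  by apply/implyP => /eqP ->.
rewrite (bigD1 i) //= eqxx big_mkcond big_bool /= addr0 big1 ?mulr1 // => j.
by move=> /negbTE ->; rewrite sum_bern.
Qed.

Let swap (J : I -> bool) (ab : env * env) : env * env :=
  ([ffun i => if J i then ab.2 i else ab.1 i],
   [ffun i => if J i then ab.1 i else ab.2 i]).

(** The product is a sum over pairs of environments. Exchanging their coordinates in [J] keeps the
    weight of a pair and turns [A] on the first and [B] on the second into both events on the
    second; the first then sums to one. *)
Lemma Pr_indep (J : I -> bool) A B :
  depon J A -> depon (fun i => ~~ J i) B ->
  Pr (fun a => A a && B a) = Pr A * Pr B.
Proof.
move=> dA dB; rewrite !PrE.
rewrite big_distrlr /= pair_big /=.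
have swapK : involutive (swap J).
  by case=> a b; rewrite /swap /=; congr (_, _); apply/ffunP => i; rewrite !ffunE /= ?ffunE; case: (J i).
rewrite (reindex_inj (inv_inj swapK)) /=.
transitivity (\sum_(ab : env * env)
    ((A ab.2 && B ab.2)%:R * cube_wt ab.2) * cube_wt ab.1).
  rewrite -(pair_bigA _ (fun a b => (A b && B b)%:R * cube_wt b * cube_wt a)) /=.
  have Pr1 : \sum_a cube_wt a = 1 by rewrite -Pr_true PrE; apply: eq_bigr => a _; rewrite mul1r.
  under [RHS]eq_bigr => a _ do rewrite -mulr_suml.
  by rewrite -mulr_sumr Pr1 mulr1.
apply: eq_bigr => -[a b] _ /=.
rewrite -(dA b); last by move=> i Ji; rewrite ffunE Ji.
rewrite -(dB b); last by move=> i /negbTE Ji; rewrite ffunE Ji.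
have -> : (A b && B b)%:R = (A b)%:R * (B b)%:R :> R.
  by case: (A b); rewrite ?mul1r ?mul0r.
rewrite [RHS]mulrACA -!mulrA; congr (_ * (_ * _)).
rewrite /cube_wt -!big_split /=; apply: eq_bigr => i _.
by rewrite !ffunE; case: ifP; rewrite // mulrC.
Qed.

Lemma depon_sub (J J' : I -> bool) A :
  (forall i, J i -> J' i) -> depon J A -> depon J' A.
Proof. by move=> JJ' dA a b ab; apply: dA => i /JJ'; apply: ab. Qed.

Lemma Pr_indep2 (J J' : I -> bool) A B :
  (forall i, J i -> ~~ J' i) -> depon J A -> depon J' B ->
  Pr (fun a => A a && B a) = Pr A * Pr B.
Proof.
move=> JJ' dA dB; apply: (Pr_indep dA); apply: depon_sub dB => i.
by apply: contraTN; apply: JJ'.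
Qed.

Lemma depon_and (J : I -> bool) A B :
  depon J A -> depon J B -> depon J (fun a => A a && B a).
Proof. by move=> dA dB a b ab; rewrite (dA a b) // (dB a b). Qed.

Lemma depon_exists (T : finType) (J : I -> bool) (A : T -> env -> bool) :
  (forall t, depon J (A t)) -> depon J (fun a => [exists t, A t a]).
Proof. by move=> dA a b ab; apply: eq_existsb => t; apply: dA. Qed.

Lemma depon_bit i : depon (pred1 i) (fun a => a i).
Proof. by move=> a b; apply => /=. Qed.

Lemma Pr_exists (T : finType) (Q : T -> bool) (A : T -> env -> bool) :
  Pr (fun a => [exists t, Q t && A t a]) <= \sum_(t | Q t) Pr (A t).
Proof.
rewrite /Pr (exchange_big_dep xpredT) //= big_mkcond /=; apply: ler_sum => a _.
case: existsP => [[t /andP[Qt At]]|_].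
  by rewrite (bigD1 t) ?Qt //= lerDl; apply: sumr_ge0 => *; apply: cube_wt_ge0.
by apply: sumr_ge0 => *; apply: cube_wt_ge0.
Qed.

Lemma Pr_or A B : Pr (fun a => A a || B a) <= Pr A + Pr B.
Proof.
rewrite !PrE -big_split /=; apply: ler_sum => a _; rewrite -mulrDl.
apply: ler_wpM2r; first exact: cube_wt_ge0.
by rewrite -natrD ler_nat; case: (A a); case: (B a).
Qed.

Lemma Pr_disjoint (T : finType) (Q : T -> bool) (A : T -> env -> bool)
    (B : env -> bool) :
  (forall t u a, Q t -> Q u -> A t a -> A u a -> t = u) ->
  (forall t a, Q t -> A t a -> B a) ->
  \sum_(t | Q t) Pr (A t) <= Pr B.
Proof.
move=> disj sub; rewrite /Pr (exchange_big_dep xpredT) //= [leRHS]big_mkcond /=.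
apply: ler_sum => a _.
have [/existsP[t /andP[Qt At]]|nA] := boolP [exists t, Q t && A t a].
  rewrite (bigD1 t) ?Qt //= big1 ?addr0 ?(sub t a) //.
  move=> u /andP[/andP[Qu Au] /eqP []]; exact: (disj u t a).
rewrite big1; first by case: ifP => // _; apply: cube_wt_ge0.
move=> t /andP[Qt At]; case/negP: nA; apply/existsP; exists t.
by rewrite Qt.
Qed.

Definition clear_bit (i : I) (a : env) : env :=
  [ffun j => if j == i then false else a j].

(** A one-bit Harris inequality. Let [B] say that [A] holds once bit [i] is cleared; it is
    independent of that bit. With the bit set [A] implies [B], with the bit clear they agree, so
    conditioning on [A] can only make the bit less likely. *)
Lemma Pr_decreasing_bit i (A : env -> bool) :
  (forall a, A a -> A (clear_bit i a)) ->
  Pr (fun a => A a && a i) <= p * Pr A.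
Proof.
move=> Adec; pose B a := A (clear_bit i a).
have dB : depon (fun j => j != i) B.
  move=> a b ab; rewrite /B; congr (A _); apply/ffunP => j; rewrite !ffunE.
  by case: eqVneq => // /ab.
have PBi : Pr (fun a => a i && B a) = p * Pr B.
  by rewrite (Pr_indep (@depon_bit i)) ?Pr_bit //; apply: depon_sub dB => j /=.
have PB : Pr B = Pr (fun a => a i && B a) + Pr (fun a => ~~ a i && B a).
  by rewrite /Pr (bigID (fun a : env => a i)) /=; congr +%R; apply: eq_bigl => a;
     rewrite andbC.
have PA : Pr A = Pr (fun a => A a && a i) + Pr (fun a => ~~ a i && B a).
  rewrite /Pr (bigID (fun a : env => a i)) /=; congr +%R; apply: eq_bigl => a.
  rewrite andbC; case ai: (a i) => //=; congr (A _).
  by apply/ffunP => j; rewrite ffunE; case: eqP => // ->.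
have xle : Pr (fun a => A a && a i) <= p * Pr B.
  by rewrite -PBi; apply: le_Pr => a /andP[/Adec] ? ->.
rewrite PA; move: PB; rewrite PBi => PB.
move: xle; set x := Pr _ => xle.
(* Once [Pr A] is written as [x + (1 - p) * Pr B], the claim is exactly this inequality. *)
have : 0 <= (1 - p) * (p * Pr B - x) by rewrite mulr_ge0 ?subr_ge0.
have -> : Pr (fun a => ~~ a i && B a) = (1 - p) * Pr B by lra.
lra.
Qed.

End BernoulliCube.

(** * The slot walk in a finite tree *)

Section SlotWalk.
Variables (W : finType) (par : W -> W) (dep : W -> nat) (K : nat).
Local Notation slot := 'I_K.+1.
Local Notation env := {ffun W * 'I_K.+1 -> bool}.

(** [par] is total on the finite set [W], hence takes a default value where the true parent lies
    outside [W]; the depth condition discards such spurious children. *)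
Definition kids (v : W) : {set W} :=
  [set c | (par c == v) && (dep c == (dep v).+1)].

Definition desc (v w : W) : bool :=
  (dep v <= dep w)%N && (iter (dep w - dep v) par w == v).

Lemma desc_refl v : desc v v.
Proof. by rewrite /desc leqnn subnn /=. Qed.

Lemma dep_kid v c : c \in kids v -> dep c = (dep v).+1.
Proof. by rewrite inE => /andP[_ /eqP]. Qed.

Lemma desc_kid v c w : c \in kids v -> desc c w -> desc v w.
Proof.
rewrite inE => /andP[/eqP pc /eqP dc] /andP[dcw /eqP icw].
rewrite /desc; apply/andP; split; first lia.
have -> : (dep w - dep v = (dep w - dep c).+1)%N by lia.
by rewrite iterS icw pc.
Qed.

Lemma kid_desc v x c : c \in kids x -> desc v x -> desc v c.
Proof.
rewrite inE => /andP[/eqP pc /eqP dc] /andP[vx /eqP ivx].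
by rewrite /desc dc (leqW vx) subSn // iterSr pc ivx eqxx.
Qed.

Lemma desc_kidN v c : c \in kids v -> ~~ desc c v.
Proof. by move=> /dep_kid dc; rewrite /desc dc ltnn. Qed.

Lemma desc_inj c c' w : dep c = dep c' -> desc c w -> desc c' w -> c = c'.
Proof. by move=> dcc /andP[_ /eqP <-] /andP[_ /eqP <-]; rewrite dcc. Qed.

Definition kidbits (a : env) v s := [set c in kids v | a (c, s)].

(* The walk on the pole of [v], about to inspect slot [s], inside the subtree
   of [v]: it answers [Some y] if within [n] steps it leaves [v] towards its
   parent across the bar in slot [y]. Two simultaneous bars kill the walk. *)
Fixpoint ret (a : env) n v s : option slot :=
  if n is n.+1 then
    if a (v, s) then Some s
    else if kidbits a v s == set0 then ret a n v (ordS s)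
    else if [pick c | kidbits a v s == [set c]] is Some c then
      if ret a n c (ordS s) is Some y then ret a n v (ordS y) else None
    else None
  else None.

Lemma retS a n v s : ret a n.+1 v s =
  if a (v, s) then Some s
  else if kidbits a v s == set0 then ret a n v (ordS s)
  else if [pick c | kidbits a v s == [set c]] is Some c then
    if ret a n c (ordS s) is Some y then ret a n v (ordS y) else None
  else None.
Proof. by []. Qed.

Lemma ret_leq a n m v s y : (n <= m)%N -> ret a n v s = Some y -> ret a m v s = Some y.
Proof.
elim: n m v s y => [//|n IH] [//|m] v s y /= nm.
case: (a (v, s)) => //; case: ifP => [_|_]; first exact: IH.
case: pickP => // c _; case E: (ret a n c _) => [z|] // E'.
by rewrite (IH _ _ _ _ nm E); exact: IH E'.
Qed.

Lemma ret_bit a n v s y : ret a n v s = Some y -> a (v, y).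
Proof.
elim: n v s y => [//|n IH] v s y /=.
case: ifP => [avs [<-] //|_]; case: ifP => [_|_]; first exact: IH.
by case: pickP => // c _; case: (ret a n c _) => // z; exact: IH.
Qed.

Lemma kidbits_sub a v s c : kidbits a v s == [set c] -> c \in kids v.
Proof. by move/eqP/setP/(_ c); rewrite !inE eqxx => /andP[->]. Qed.

(** The walk stops on leaving the subtree of [v], so it reads only edges at or below [v]. The
    independence of excursions rests on this. *)
Lemma eq_ret (a b : env) n v s : (forall w t, desc v w -> a (w, t) = b (w, t)) ->
  ret a n v s = ret b n v s.
Proof.
elim: n v s => [//|n IH] v s ab /=; rewrite ab ?desc_refl //.
have -> : kidbits a v s = kidbits b v s.
  apply/setP => c; rewrite in_set [in RHS]in_set; case cv: (c \in kids v) => //=.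
  exact: ab (desc_kid cv (desc_refl c)).
case: (b _) => //; case: ifP => _; first exact: IH.
case: pickP => // c /kidbits_sub cv.
rewrite (IH c) => [|w t /(desc_kid cv)/ab //].
by case: (ret _ _ _ _) => // y; exact: IH.
Qed.

Lemma depon_ret n v s (Q : option slot -> bool) :
  depon (fun i => desc v i.1) (fun a : env => Q (ret a n v s)).
Proof. by move=> a b ab; rewrite (@eq_ret a b) // => w t; exact: (ab (w, t)). Qed.

(** A bar above [v] ends the walk as soon as it is inspected, so a walk exiting in [y] never met any
    other bar of this edge. *)
Lemma ret_clear_bit a n v s y u : u != y ->
  ret a n v s = Some y -> ret (clear_bit (v, u) a) n v s = Some y.
Proof.
move=> uy; elim: n s => [//|n IH] s /=.
have clearE w t : w != v -> clear_bit (v, u) a (w, t) = a (w, t).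
  by move=> wv; rewrite ffunE ifN //; apply: contraNneq wv => -[->].
have -> : kidbits (clear_bit (v, u) a) v s = kidbits a v s.
  apply/setP => c; rewrite in_set [in RHS]in_set; case cv: (c \in kids v) => //=.
  by apply: clearE; apply/eqP => cv'; move: (dep_kid cv); rewrite cv'; lia.
case: ifP => [avs [sy]|/negbT avs]; rewrite ffunE.
  have -> : ((v, s) == (v, u)) = false by rewrite xpair_eqE eqxx sy eq_sym (negbTE uy).
  by rewrite avs sy.
rewrite (negbTE avs) if_same; case: ifP => [_|_]; first exact: IH.
case: pickP => // c /kidbits_sub cv.
rewrite (@eq_ret _ a n c).
  by case: (ret _ _ _ _) => // z; exact: IH.
move=> w t cw; apply: clearE; apply/eqP => wv.
by have := desc_kidN cv; rewrite -wv cw.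
Qed.

(* Offset of [s] when the slots are read cyclically from [h]. *)
Definition off (h s : slot) : nat := if (h <= s)%N then (s - h)%N else (s + K.+1 - h)%N.

Lemma off_le h s : (off h s <= K)%N.
Proof. by rewrite /off; case: ifP; have := ltn_ord s; have := ltn_ord h; lia. Qed.

Lemma off_inj h : injective (off h).
Proof.
move=> s t; rewrite /off => E; apply: val_inj => /=.
by move: E; have := ltn_ord s; have := ltn_ord t; have := ltn_ord h; do 2 case: ifP; lia.
Qed.

Lemma off0 h : off h h = 0%N. Proof. by rewrite /off leqnn subnn. Qed.

Lemma val_ordS (s : slot) : val (ordS s) = if val s == K then 0%N else s.+1.
Proof.
rewrite /=; case: eqP => [->|/eqP sK]; first exact: modnn.
by rewrite modn_small //; have := ltn_ord s; lia.
Qed.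

Lemma off_ordS h s : (off h s < K)%N -> off h (ordS s) = (off h s).+1.
Proof.
rewrite /off (_ : nat_of_ord (ordS s) = val (ordS s)) // val_ordS /=.
by case: eqP; have := ltn_ord s; have := ltn_ord h; do 2 case: ifP; lia.
Qed.

Lemma big_off (R : Type) (idx : R) (op : Monoid.com_law idx) h (Q : nat -> bool) (F : nat -> R) :
  \big[op/idx]_(s : slot | Q (off h s)) F (off h s) = \big[op/idx]_(j < K.+1 | Q j) F j.
Proof.
pose f s : slot := Ordinal (off_le h s : (off h s < K.+1)%N).
have f_inj : injective f by move=> s t [/off_inj].
by rewrite [RHS](reindex_inj f_inj).
Qed.

Lemma card_off h lo hi : (hi <= K.+1)%N ->
  #|[pred s : slot | (lo < off h s < hi)%N]| = (hi - lo.+1)%N.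
Proof.
move=> hiK; rewrite -sum1_card (big_off _ h (fun j => (lo < j < hi)%N) (fun=> 1%N)).
transitivity (\sum_(lo.+1 <= j < hi) 1)%N; last by rewrite sum_nat_const_nat muln1.
rewrite (big_nat_widenl _ 0) // (big_nat_widen _ _ K.+1) // big_mkord.
by apply: eq_bigl => j; rewrite /= ?andbT.
Qed.


Definition none (h : slot) (C : {set W}) lo hi (a : env) : bool :=
  [forall i : W * slot, [&& i.1 \in C & (lo < off h i.2 < hi)%N] ==> ~~ a i].

(** The history of the edge above [w] when the walk enters: the bar in [x] being crossed and a set
    [A] of slots already known to be empty. The return bound is proved for every such history. *)
Definition entered (w : W) (x : slot) (A : slot -> bool) (a : env) : bool :=
  a (w, x) && [forall s, A s ==> ~~ a (w, s)].

(* [w] carries the first bar with an end in [C] after offset [lo], in slot [x]. *)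
Definition first_bar (h : slot) C lo w x (a : env) : bool :=
  none h (C :\ w) lo (off h x).+1 a &&
  entered w x (fun s => lo < off h s < off h x)%N a.

Lemma noneP h (C : {set W}) lo hi (a : env) :
  reflect (forall c s, c \in C -> (lo < off h s)%N -> (off h s < hi)%N -> ~~ a (c, s))
          (none h C lo hi a).
Proof.
apply: (iffP forallP) => [H c s cC ls sh|H [c s]].
  by have /implyP := H (c, s); apply; rewrite cC ls.
by apply/implyP => /and3P[]; exact: H.
Qed.

Lemma none_sub h (C C' : {set W}) lo hi hi' (a : env) :
  C' \subset C -> (hi' <= hi)%N -> none h C lo hi a -> none h C' lo hi' a.
Proof.
move=> /subsetP CC hh /noneP H; apply/noneP => c s /CC cC ls sh.
by apply: H => //; lia.
Qed.

Lemma first_bar_bit h C lo w x a : first_bar h C lo w x a -> a (w, x).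
Proof. by case/andP=> _ /andP[]. Qed.

Lemma first_bar_none h C lo w x a : first_bar h C lo w x a -> none h C lo (off h x) a.
Proof.
case/andP => /noneP H1 /andP[_ /forallP H2]; apply/noneP => c s cC ls sx.
case: (eqVneq c w) => [->|cw]; first by have := H2 s; rewrite ls sx.
by apply: H1 => //; [rewrite !inE cw | lia].
Qed.

Lemma first_bar_inj h (C : {set W}) lo w x w' x' a :
  w \in C -> w' \in C -> (lo < off h x)%N -> (lo < off h x')%N ->
  first_bar h C lo w x a -> first_bar h C lo w' x' a -> (w, x) = (w', x').
Proof.
move=> wC wC' lx lx' f f'.
have [xx|xx|xx] := ltngtP (off h x) (off h x').
- by have /noneP/(_ w x wC lx xx) := first_bar_none f'; rewrite (first_bar_bit f).
- by have /noneP/(_ w' x' wC' lx' xx) := first_bar_none f; rewrite (first_bar_bit f').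
- move/off_inj: xx => xx; subst x'; congr (_, _); apply/eqP/negPn/negP => ww.
  case/andP: f => /noneP/(_ w' x) H _; move: H; rewrite !inE eq_sym ww wC' lx ltnSn.
  by move=> /(_ isT isT isT); rewrite (first_bar_bit f').
Qed.

(** Follows the walk to the first bar met on the pole of [v]: to the parent, or to a child. Offset
    [K] is the last one before the reading wraps round to [h], so a walk that gets past it has seen
    no child bar after [lo]. *)
Lemma ret_cases h a n v s y lo : off h s = lo.+1 -> ret a n.+1 v s = Some y ->
  [\/ exists s', [/\ (lo < off h s')%N, a (v, s') & none h (kids v) lo (off h s') a],
      none h (kids v) lo K.+1 a |
      exists c s' z, [/\ c \in kids v, (lo < off h s')%N, first_bar h (kids v) lo c s' a,
        ret a n c (ordS s') = Some z & ret a n v (ordS z) = Some y]].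
Proof.
elim: n s lo => [|n IH] s lo os.
  rewrite retS; case: ifP => [avs _|_].
    constructor 1; exists s; split; rewrite ?os //; apply/noneP => *; lia.
  by case: ifP => // _; case: pickP => // c _; case: ifP.
rewrite retS; case: ifP => [avs _|avs].
  constructor 1; exists s; split; rewrite ?os //; apply/noneP => *; lia.
case: ifP => [/eqP k0|_].
  have none_cons hi : none h (kids v) lo.+1 hi a -> none h (kids v) lo hi a.
    move=> /noneP H; apply/noneP => c t cv lt th.
    have [ot|ot] := eqVneq (off h t) lo.+1; last by apply: H => //; lia.
    have -> : t = s by apply: (@off_inj h); rewrite ot os.
    by move/setP/(_ c): k0; rewrite in_set in_set0 cv /= => ->.
  case: (ltnP (off h s) K) => sK.
    move=> /(IH _ lo.+1 (etrans (off_ordS sK) (congr1 S os))) [].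
    - move=> [s' [ls' av no]]; constructor 1; exists s'; split => //; first by lia.
      exact: none_cons.
    - by move=> no; constructor 2; apply: none_cons.
    - move=> [c [s' [z [cv ls' fb r1 r2]]]]; constructor 3; exists c, s', z.
      split => //; [by lia| |exact: ret_leq r1|exact: ret_leq r2].
      have /none_cons/noneP no := first_bar_none fb; case/andP: fb => fb1 /andP[fb2 fb3].
      apply/andP; split; last first.
        rewrite /entered fb2 /=; apply/forallP => t; apply/implyP => /andP[lt tx].
        exact: no.
      apply/noneP => c' t; rewrite !inE => /andP[cc c'v] lt ts.
      have [ot|ot] := eqVneq (off h t) (off h s').
        by move/noneP: fb1; apply; rewrite ?inE ?cc //; lia.
      by apply: no; rewrite ?inE //; lia.
  move=> _; constructor 2; apply: none_cons; apply/noneP => c t _ lt tK.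
  by have := off_le h s; lia.
case: pickP => // c /eqP kc; case r1: (ret a n.+1 c _) => [z|] // r2.
constructor 3; exists c, s, z.
have cv : c \in kids v by apply: kidbits_sub; apply/eqP; exact: kc.
split => //; first by rewrite os.
have kcE c' : (c' \in kids v) && a (c', s) = (c' == c).
  by move/setP/(_ c'): kc; rewrite in_set in_set1.
apply/andP; split; last first.
  rewrite /entered; have := kcE c; rewrite eqxx => /andP[_ ->] /=.
  by apply/forallP => t; apply/implyP; lia.
apply/noneP => c' t; rewrite in_setD1 => /andP[cc c'v] lt ts.
have -> : t = s by apply: (@off_inj h); lia.
by have := kcE c'; rewrite c'v (negbTE cc) /= => ->.
Qed.

End SlotWalk.

(** * Return probabilities *)

Section ReturnProbability.
Variables (R : realFieldType) (W : finType) (par : W -> W) (dep : W -> nat).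
Variables (K M k L : nat) (p gam : R).
Local Notation slot := 'I_K.+1.
Local Notation env := {ffun W * 'I_K.+1 -> bool}.
Local Notation kids := (kids par dep).
Local Notation desc := (desc par dep).
Local Notation ret := (@ret W par dep K).
Local Notation Pr := (@Pr R (W * 'I_K.+1)%type p).
Local Notation x := ((1 - p) ^+ k).
Hypotheses (p_ge0 : 0 <= p) (p_le1 : p <= 1) (LK : (L < K)%N).
(** Strict, so that [k] children remain after the one visited first is excluded. *)
Hypothesis many_kids : forall v, (dep v < M)%N -> (k < #|kids v|)%N.
Hypothesis geom : forall n, p * \sum_(j < n) x ^+ j <= gam.
(** In order: a parent bar comes first, no early child bar, a late bar of the first child. The
    bracket is weighted by the bound 1/2 on the return of the first child: no second child bar,
    parent first, first child again, second child returns. *)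
Hypothesis budget :
  gam + x ^+ L + (K.+1 - L)%:R * p + 2^-1 * (x ^+ (K - L) + gam + gam + 2^-1) <= 2^-1.

Let q_ge0 : 0 <= 1 - p. Proof. by rewrite subr_ge0. Qed.
Let q_le1 : 1 - p <= 1. Proof. by rewrite lerBlDr lerDl. Qed.

Let x_ge0 : 0 <= x. Proof. exact: exprn_ge0 q_ge0. Qed.

Lemma gam_ge0 : 0 <= gam.
Proof. by have := geom 0; rewrite big_ord0 mulr0. Qed.

Lemma Pr_none (h : slot) (C : {set W}) lo hi : (hi <= K.+1)%N -> (k <= #|C|)%N ->
  Pr (none h C lo hi) <= x ^+ (hi - lo.+1).
Proof.
move=> hiK kC.
rewrite (Pr_zero p (fun i : W * slot => (i.1 \in C) && (lo < off h i.2 < hi)%N)).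
have -> : #|[pred i : W * slot | (i.1 \in C) && (lo < off h i.2 < hi)%N]| =
          (#|C| * (hi - lo.+1))%N.
  by rewrite -(card_off h lo hiK) -cardX; apply: eq_card => i.
by rewrite -exprM; apply: ler_wiXn2l; rewrite ?leq_mul ?q_ge0 ?q_le1.
Qed.

Lemma depon_none (h : slot) (C : {set W}) lo hi :
  depon (fun i : W * slot => (i.1 \in C) && (lo < off h i.2 < hi)%N) (none h C lo hi).
Proof.
by move=> a b ab; apply: eq_forallb => i; case E: (_ && _) => //=; rewrite ab.
Qed.

Lemma depon_entered (w : W) (s : slot) A :
  depon (fun i : W * slot => (i.1 == w) && ((i.2 == s) || A i.2)) (entered w s A).
Proof.
move=> a b ab; rewrite /entered ab /= ?eqxx //; congr andb; apply: eq_forallb => t.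
by case At: (A t) => //=; rewrite ab //= eqxx At orbT.
Qed.

Lemma clear_bit_neq (i j : W * slot) (a : env) : j != i -> clear_bit i a j = a j.
Proof. by move=> /negbTE ji; rewrite ffunE ji. Qed.

Lemma clear_bitN i (a : env) j : ~~ a j -> ~~ clear_bit i a j.
Proof. by rewrite ffunE; case: eqP. Qed.

Lemma entered_clear_bit (w : W) (s t : slot) A a :
  t != s -> entered w s A a -> entered w s A (clear_bit (w, t) a).
Proof.
move=> ts /andP[aws /forallP H]; apply/andP; split.
  by rewrite clear_bit_neq // xpair_eqE eqxx eq_sym.
by apply/forallP => u; apply/implyP => Au; apply: clear_bitN; exact: (implyP (H u)).
Qed.

Lemma none_clear_bit (h : slot) (C : {set W}) lo hi i a :
  none h C lo hi a -> none h C lo hi (clear_bit i a).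
Proof.
move=> /forallP H; apply/forallP => j; apply/implyP => Hj; apply: clear_bitN.
exact: (implyP (H j)).
Qed.

Lemma Pr_entered_bit (w : W) (s t : slot) A : t != s ->
  Pr (fun a => entered w s A a && a (w, t)) <= p * Pr (entered w s A).
Proof. by move=> ts; apply: Pr_decreasing_bit => // a; exact: entered_clear_bit. Qed.

(** Governs the chance that after offset [lo] one edge has a bar before [k] other edges do: these
    are empty for [j] slots with probability [x ^+ j], then the bar has probability [p]. *)
Lemma geom_off (h : slot) lo :
  (\sum_(s : slot | (lo < off h s)%N) x ^+ (off h s - lo.+1)) * p <= gam.
Proof.
rewrite (big_off _ h (fun j => lo < j)%N (fun j => x ^+ (j - lo.+1))) mulrC.
apply: le_trans (geom (K.+1 - lo.+1)); rewrite ler_wpM2l //.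
rewrite -(big_mkord (fun j => lo < j)%N (fun j => x ^+ (j - lo.+1))).
have -> : \sum_(0 <= j < K.+1 | (lo < j)%N) x ^+ (j - lo.+1) =
          \sum_(lo.+1 <= j < K.+1) x ^+ (j - lo.+1) 
  by rewrite [RHS](big_nat_widenl _ 0) //; apply: eq_bigl => j; rewrite ?andbT.
rewrite -{1}[lo.+1]add0n big_addn big_mkord.
by apply: ler_sum => j _; rewrite addnK.
Qed.

Lemma kids_desc v c w : c \in kids v -> w \in kids v -> desc w c -> c = w.
Proof.
move=> cv wv wc; apply: desc_inj (desc_refl par dep c) wc.
by rewrite (dep_kid cv) (dep_kid wv).
Qed.

(** * One step of the recursion, at a single vertex *)

Section OneVertex.
Variables (v : W) (h : slot) (A : slot -> bool) (n : nat).
Hypotheses (vM : (dep v < M)%N) (Ah : ~~ A h).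
Hypothesis IH : forall c (s : slot) B, c \in kids v -> ~~ B s ->
  Pr (fun a => entered c s B a && (ret a n c (ordS s) != None))
    <= 2^-1 * Pr (entered c s B).
Local Notation off := (off h).
Local Notation none := (none h).
Local Notation Y := (entered v h A).

Lemma kidsD1_ge w : (k <= #|kids v :\ w|)%N.
Proof. by have := many_kids vM; rewrite (cardsD1 w); case: (w \in _); lia. Qed.

Lemma kids_ge : (k <= #|kids v|)%N. Proof. exact: ltnW (many_kids vM). Qed.

Lemma v_notin_kids : v \notin kids v.
Proof. by apply/negP => /dep_kid; lia. Qed.

Definition kid_returns (wx : W * slot) (z : slot) (a : env) : bool :=
  first_bar h (kids v) 0 wx.1 wx.2 a && (ret a n wx.1 (ordS wx.2) == Some z).

Definition early_entry (wx : W * slot) := (wx.1 \in kids v) && (0 < off wx.2 <= L)%N.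
Definition early_exit (wx : W * slot) (z : slot) := (off wx.2 <= off z <= L)%N.

(** A first excursion to [w] with return in [z] reveals the siblings of [w] only up to the entry
    offset, which is at most [off z]. Their later bars stay fresh, and so does the edge above
    [v]. *)
Lemma depon_kid_returns wx z : early_entry wx -> early_exit wx z ->
  depon (fun i => ~~ ((i.1 \in kids v :\ wx.1) && (off z < off i.2)%N) && (i.1 != v))
        (kid_returns wx z).
Proof.
case: wx => w s /andP[/= wv /andP[s0 sL]] /andP[/= sz zL].
have wNv : w != v by apply: contraTneq wv => ->; exact: v_notin_kids.
apply: depon_and; first apply: depon_and.
- apply: depon_sub (@depon_none _ _ _ _) => -[c t] /= /andP[cK /andP[t0 ts]].
  have cv : c != v by apply: contraTneq cK => ->; rewrite in_setD1 (negbTE v_notin_kids) andbF.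
  by rewrite cv andbT negb_and -leqNgt (leq_trans _ sz) ?orbT.
- apply: depon_sub (@depon_entered _ _ _) => -[c t] /= /andP[/eqP -> _].
  by rewrite in_setD1 eqxx wNv.
- apply: depon_sub (@depon_ret _ _ _ _ _ _ _ (fun o => o == Some z)) => -[c t] /= wc.
  apply/andP; split.
    rewrite in_setD1; apply/negP => /andP[/andP[cw cv] _].
    by case/negP: cw; apply/eqP; exact: kids_desc cv wv wc.
  by apply: contraTneq wc => ->; exact: desc_kidN wv.
Qed.

Lemma sum_first_bar : \sum_(wx | early_entry wx) Pr (first_bar h (kids v) 0 wx.1 wx.2) <= 1.
Proof.
rewrite -(@Pr_true R (W * slot)%type p); apply: Pr_disjoint => //.
move=> [w s] [w' s'] a /andP[/= wv /andP[s0 _]] /andP[/= wv' /andP[s0' _]].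
exact: first_bar_inj.
Qed.

(** [first_bar] splits into a condition on the siblings, independent of the subtree of [w], and an
    [entered] event for [w], to which the induction hypothesis applies. *)
Lemma first_bar_ret lo w (s : slot) : w \in kids v ->
  Pr (fun a => first_bar h (kids v) lo w s a && (ret a n w (ordS s) != None))
    <= 2^-1 * Pr (first_bar h (kids v) lo w s).
Proof.
move=> wv; set B := fun t => (lo < off t < off s)%N.
have dis : forall i : W * slot, (i.1 \in kids v :\ w) && (lo < off i.2 < (off s).+1)%N ->
    ~~ desc w i.1.
  move=> [c t] /= /andP[]; rewrite in_setD1 => /andP[cw cv] _.
  by apply: contraNN cw => wc; apply/eqP; exact: kids_desc cv wv wc.
have dE : depon (fun i => desc w i.1) (entered w s B).
  by apply: depon_sub (@depon_entered _ _ _) => i /andP[/eqP -> _]; exact: desc_refl.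
rewrite (eq_Pr p (B := fun a => none (kids v :\ w) lo (off s).+1 a &&
  (entered w s B a && (ret a n w (ordS s) != None)))); last by move=> a; rewrite /first_bar andbA.
rewrite (Pr_indep2 _ dis (@depon_none _ _ _ _)); last first.
  exact: depon_and dE (@depon_ret _ _ _ _ _ _ _ (fun o => o != None)).
rewrite (Pr_indep2 _ dis (@depon_none _ _ _ _) dE) mulrCA ler_wpM2l ?Pr_ge0 //.
by apply: IH => //; rewrite /B ltnn andbF.
Qed.

Lemma sum_kid_returns :
  \sum_(wx | early_entry wx) \sum_(z | early_exit wx z) Pr (kid_returns wx z) <= 2^-1.
Proof.
apply: (@le_trans _ _ (\sum_(wx | early_entry wx) 2^-1 * Pr (first_bar h (kids v) 0 wx.1 wx.2))).
  apply: ler_sum => -[w s] /andP[/= wv _]; apply: le_trans (first_bar_ret _ _ wv).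
  apply: Pr_disjoint => //= [z z' a _ _ /andP[_ /eqP E] /andP[_ /eqP E']|z a _].
    by move: E'; rewrite E => -[].
  by case/andP => -> /eqP /= ->.
by rewrite -mulr_sumr -[leRHS]mulr1 ler_wpM2l ?invr_ge0 // sum_first_bar.
Qed.

(** A union bound: [c] bounds the second stage conditionally on the first excursion, and the
    returning excursions have total probability at most 1/2. *)
Lemma Pr_after_kid_returns (E : W * slot -> slot -> env -> bool) c : 0 <= c ->
  (forall wx z, early_entry wx -> early_exit wx z -> Pr (E wx z) <= c * Pr (kid_returns wx z)) ->
  Pr (fun a => [exists wx, early_entry wx && [exists z, early_exit wx z && E wx z a]]) <= c * 2^-1.
Proof.
move=> c0 EG; apply: le_trans (Pr_exists p_ge0 p_le1 _ _) _.
apply: le_trans (ler_wpM2l c0 sum_kid_returns); rewrite mulr_sumr; apply: ler_sum => wx q1.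
apply: le_trans (Pr_exists p_ge0 p_le1 _ _) _.
by rewrite mulr_sumr; apply: ler_sum => z q2; exact: EG.
Qed.

(* The walk entered [v] in slot [h]; offsets are counted from [h] and a slot is
   late if its offset exceeds [L]. Returning to the parent forces one of the
   seven events below: either the first excursion to a child [w] does not even
   take place or is spoilt by a late bar of [w], or it returns in an early slot
   [z] and no second excursion, to another child, escapes. *)
Definition parent_first a :=
  [exists s, (0 < off s)%N && (Y a && a (v, s) && none (kids v) 0 (off s) a)].
Definition no_early_kid a := none (kids v) 0 L.+1 a.
Definition late_bar a := [exists wx, early_entry wx && [exists z,
  ((off z == 0) || (L < off z))%N && (first_bar h (kids v) 0 wx.1 wx.2 a && a (wx.1, z))]].
Definition no_second_kid a := [exists wx, early_entry wx && [exists z, early_exit wx z &&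
  (kid_returns wx z a && none (kids v :\ wx.1) (off z) K.+1 a)]].
Definition parent_second a :=
  [exists wx, early_entry wx && [exists z, early_exit wx z &&
   [exists s, (off z < off s)%N &&
  (Y a && a (v, s) && (kid_returns wx z a && none (kids v :\ wx.1) (off z) (off s) a))]]].
Definition first_kid_again a :=
  [exists wx, early_entry wx && [exists z, early_exit wx z &&
   [exists s, (off z < off s)%N &&
  (kid_returns wx z a && a (wx.1, s) && none (kids v :\ wx.1) (off z) (off s) a)]]].
Definition second_kid_returns a :=
  [exists wx, early_entry wx && [exists z, early_exit wx z &&
   [exists wx2,
  ((wx2.1 \in kids v :\ wx.1) && (off z < off wx2.2)%N) &&
  (kid_returns wx z a && first_bar h (kids v :\ wx.1) (off z) wx2.1 wx2.2 a &&
   (ret a n wx2.1 (ordS wx2.2) != None))]]].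

Lemma depon_Y : depon (fun i => i.1 == v) Y.
Proof. by apply: depon_sub (@depon_entered _ _ _) => i /andP[]. Qed.

Lemma depon_Y_bit s : depon (fun i => i.1 == v) (fun a => Y a && a (v, s)).
Proof.
apply: (depon_and depon_Y); apply: depon_sub (@depon_bit _ _) => i /eqP -> //=.
Qed.

Lemma depon_none_kids (C : {set W}) lo hi : C \subset kids v ->
  depon (fun i => i.1 != v) (none C lo hi).
Proof.
move=> /subsetP CK; apply: depon_sub (@depon_none _ _ _ _) => i /andP[/CK iv _].
by apply: contraTneq iv => ->; exact: v_notin_kids.
Qed.

Lemma Pr_Y_indep B : depon (fun i => i.1 != v) B -> Pr (fun a => Y a && B a) = Pr Y * Pr B.
Proof. by move=> dB; exact: (Pr_indep p depon_Y dB). Qed.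

Lemma Pr_parent_first : Pr parent_first <= gam * Pr Y.
Proof.
apply: le_trans (Pr_exists p_ge0 p_le1 _ _) _.
apply: le_trans (ler_wpM2r (Pr_ge0 p_ge0 p_le1 Y) (geom_off h 0)).
rewrite -mulrA mulr_suml; apply: ler_sum => s s0.
rewrite (Pr_indep p (@depon_Y_bit s)); last exact: depon_none_kids.
rewrite mulrC; apply: ler_pM; rewrite ?Pr_ge0 //.
  by apply: Pr_none; [exact: leqW (off_le h s)|exact: kids_ge].
by apply: Pr_entered_bit; apply: contraTneq s0 => ->; rewrite off0.
Qed.

Lemma Pr_no_early_kid : Pr no_early_kid <= x ^+ L.
Proof. by have := @Pr_none h (kids v) 0 L.+1 (leqW LK) kids_ge; rewrite subSS subn0. Qed.

(** An early entry reveals bars of [w] only at offsets from 1 to [L], so each late bar of [w] is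
    independent of it. *)
Lemma Pr_late_bar : Pr late_bar <= (K.+1 - L)%:R * p.
Proof.
apply: le_trans (Pr_exists p_ge0 p_le1 _ _) _.
apply: (@le_trans _ _ (\sum_(wx | early_entry wx)
   Pr (first_bar h (kids v) 0 wx.1 wx.2) * ((K.+1 - L)%:R * p))); last first.
  rewrite -mulr_suml -[leRHS]mul1r ler_wpM2r ?sum_first_bar //.
  by rewrite mulr_ge0 ?ler0n.
apply: ler_sum => -[w s] /andP[/= wv /andP[s0 sL]].
apply: le_trans (Pr_exists p_ge0 p_le1 _ _) _.
rewrite (eq_bigr (fun=> Pr (first_bar h (kids v) 0 w s) * p)); last first.
  move=> z zwin; rewrite (Pr_indep p (J := fun i => i != (w, z))).
  - by rewrite Pr_bit.
  - apply: depon_and.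
      apply: depon_sub (@depon_none _ _ _ _) => -[c t] /= /andP[cw _].
      by apply: contraTneq cw => -[-> _]; rewrite in_setD1 eqxx.
    apply: depon_sub (@depon_entered _ _ _) => -[c t] /= /andP[_ tt].
    apply: contraTneq tt => -[_ ->]; rewrite negb_or; apply/andP; split; last by lia.
    by apply: contraTneq zwin => ->; lia.
  - by apply: depon_sub (@depon_bit _ _) => i /eqP ->; rewrite eqxx.
rewrite big_const -Monoid.iteropE -[iterop _ _ _ _]/(_ *+ _) -mulr_natr -mulrA [p * _]mulrC.
rewrite ler_wpM2l ?Pr_ge0 // ler_wpM2r // ler_nat.
(* The late slots are the [K - L] offsets beyond [L], and offset 0, that is [h] itself, which is
   read last in the round. *)
rewrite -sum1_card (big_off _ h (fun j => (j == 0) || (L < j))%N (fun=> 1%N)).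
rewrite big_mkcond big_ord_recl /= add1n subSn ?(ltnW LK) // ltnS.
rewrite -(big_mkord xpredT (fun i => if (bump 0 i == 0) || (L < bump 0 i) then 1 else 0))%N.
rewrite (big_cat_nat _ (n := L)) ?(ltnW LK) //= big1_seq ?add0n; last first.
  by move=> i; rewrite mem_index_iota /bump /= => iL; rewrite ifF //; lia.
rewrite -[leqRHS]muln1 -sum_nat_const_nat; apply: leq_sum => i _; by case: ifP.
Qed.

Lemma Pr_indep_none wx z hi B : early_entry wx -> early_exit wx z -> (hi <= K.+1)%N ->
  depon (fun i => ~~ ((i.1 \in kids v :\ wx.1) && (off z < off i.2)%N)) B ->
  Pr (fun a => B a && none (kids v :\ wx.1) (off z) hi a) <= Pr B * x ^+ (hi - (off z).+1).
Proof.
move=> q1 q2 hiK dB.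
rewrite (Pr_indep2 p (J' := fun i => (i.1 \in kids v :\ wx.1) && (off z < off i.2 < hi)%N) _ dB).
- by rewrite ler_wpM2l ?Pr_ge0 //; apply: Pr_none => //; exact: kidsD1_ge.
- by move=> i; apply: contraNN => /and3P[-> ->].
- exact: depon_none.
Qed.

Lemma depon_kid_returns' wx z : early_entry wx -> early_exit wx z ->
  depon (fun i => ~~ ((i.1 \in kids v :\ wx.1) && (off z < off i.2)%N)) (kid_returns wx z).
Proof. by move=> q1 q2; apply: depon_sub (depon_kid_returns q1 q2) => i /andP[]. Qed.

Lemma depon_kid_returns_v wx z : early_entry wx -> early_exit wx z ->
  depon (fun i => i.1 != v) (kid_returns wx z).
Proof. by move=> q1 q2; apply: depon_sub (depon_kid_returns q1 q2) => i /andP[]. Qed.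

Lemma Pr_no_second_kid : Pr no_second_kid <= x ^+ (K - L) * 2^-1.
Proof.
apply: Pr_after_kid_returns => [|wx z q1 q2]; first exact: exprn_ge0 x_ge0.
apply: le_trans (Pr_indep_none q1 q2 (leqnn _) (depon_kid_returns' q1 q2)) _.
rewrite mulrC ler_wpM2r ?Pr_ge0 // subSS.
(* As [off z <= L], at least [K - L] slots are left after the return. *)
have /andP[_ zL] := q2; apply: ler_wiXn2l; rewrite ?x_ge0 //; last by lia.
by apply: exprn_ile1; [exact: q_ge0|exact: q_le1].
Qed.

Lemma Pr_parent_second : Pr parent_second <= gam * Pr Y * 2^-1.
Proof.
apply: Pr_after_kid_returns => [|wx z q1 q2]; first by rewrite mulr_ge0 ?gam_ge0 ?Pr_ge0.
apply: le_trans (Pr_exists p_ge0 p_le1 _ _) _.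
have c0 : 0 <= Pr Y * Pr (kid_returns wx z) by rewrite mulr_ge0 ?Pr_ge0.
rewrite -mulrA; apply: le_trans (ler_wpM2r c0 (geom_off h (off z))).
rewrite -mulrA mulr_suml; apply: ler_sum => s zs.
rewrite (Pr_indep p (@depon_Y_bit s)); last first.
  by apply: depon_and (depon_kid_returns_v q1 q2) _; apply: depon_none_kids; exact: subD1set.
have sh : s != h by apply: contraTneq zs => ->; rewrite off0.
have hiK : (off s <= K.+1)%N by exact: leqW (off_le h s).
apply: le_trans (ler_pM (Pr_ge0 p_ge0 p_le1 _) (Pr_ge0 p_ge0 p_le1 _)
  (Pr_entered_bit v A sh) (Pr_indep_none q1 q2 hiK (depon_kid_returns' q1 q2))) _.
by rewrite le_eqVlt; apply/orP; left; apply/eqP; ring.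
Qed.

(** The new bar shares its edge with the first excursion, whence [Pr_decreasing_bit]: clearing a bar
    of [w] beyond [off z] disturbs neither the entry, which is at offset at most [off z], nor the
    exit in [z]. *)
Lemma Pr_first_kid_again : Pr first_kid_again <= gam * 2^-1.
Proof.
apply: Pr_after_kid_returns => [|wx z q1 q2]; first exact: gam_ge0.
apply: le_trans (Pr_exists p_ge0 p_le1 _ _) _.
apply: le_trans (ler_wpM2r (Pr_ge0 p_ge0 p_le1 _) (geom_off h (off z))).
rewrite -mulrA mulr_suml; apply: ler_sum => s zs.
have dbit : depon (fun i => ~~ ((i.1 \in kids v :\ wx.1) && (off z < off i.2)%N))
               (fun a : env => a (wx.1, s)).
  by apply: depon_sub (@depon_bit _ _) => i /eqP -> /=; rewrite in_setD1 eqxx.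
apply: le_trans (Pr_indep_none q1 q2 _ (depon_and (depon_kid_returns' q1 q2) dbit)) _.
  exact: leqW (off_le h s).
rewrite mulrC ler_wpM2l ?(exprn_ge0 _ x_ge0) //; apply: Pr_decreasing_bit => // a.
have /andP[xz zL] := q2.
case/andP => /andP[no en] /eqP r; apply/andP; split; first (apply/andP; split).
- exact: none_clear_bit.
- by apply: entered_clear_bit en; apply: contraTneq zs => ->; rewrite -leqNgt.
- by apply/eqP; apply: ret_clear_bit r; apply: contraTneq zs => ->; rewrite ltnn.
Qed.

(** All that is known about the edge of [w2] is gathered in one [entered] event: its slots [A2] are
    empty, up to the first entry and between the return and [s2]. The rest, [Z], does not look into
    the subtree of [w2], so the induction hypothesis gives a second factor 1/2. *)
Lemma Pr_second_kid_returns : Pr second_kid_returns <= 2^-1 * 2^-1.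
Proof.
apply: Pr_after_kid_returns => [|[w s] z q1 q2]; first by rewrite invr_ge0 ler0n.
apply: le_trans (Pr_exists p_ge0 p_le1 _ _) _.
apply: (@le_trans _ _ (\sum_(wx2 | (wx2.1 \in kids v :\ w) && (off z < off wx2.2)%N)
  2^-1 * Pr (fun a => kid_returns (w, s) z a && first_bar h (kids v :\ w) (off z) wx2.1 wx2.2 a))); last first.
  rewrite -mulr_sumr ler_wpM2l ?invr_ge0 ?ler0n //; apply: Pr_disjoint => //.
    move=> [w2 s2] [w3 s3] a /andP[/= ? ?] /andP[/= ? ?] /andP[_ f2] /andP[_ f3].
    exact: first_bar_inj f2 f3.
  by move=> t a _ /andP[].
have /andP[/= wv /andP[s0 sL]] := q1; have /andP[/= sz zL] := q2.
apply: ler_sum => -[w2 s2] /andP[/= w2K zs2].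
have /andP[w2w w2v] : (w2 != w) && (w2 \in kids v) by move: w2K; rewrite in_setD1.
pose A2 t := ((0 < off t <= off s) || (off z < off t < off s2))%N.
pose Z a := [&& none (kids v :\ w :\ w2) 0 (off s).+1 a,
  entered w s (fun t => 0 < off t < off s)%N a, ret a n w (ordS s) == Some z &
  none (kids v :\ w :\ w2) (off z) (off s2).+1 a].
have E a : kid_returns (w, s) z a && first_bar h (kids v :\ w) (off z) w2 s2 a =
           Z a && entered w2 s2 A2 a.
  apply/andP/andP => [[/andP[/andP[/= /noneP n1 e1] r1] /andP[/noneP n2 /andP[b2 /forallP e2]]]|].
    split; last first.
      rewrite /entered b2; apply/forallP => t; apply/implyP => /orP[/andP[t0 ts]|tz].
        by apply: n1 => //; rewrite ?in_setD1 ?w2w.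
      exact: (implyP (e2 t)).
    apply/and4P; split => //; apply/noneP => c t; rewrite in_setD1 => /andP[cw2 cK] l1 l2.
      exact: n1.
    by apply: n2 => //; rewrite in_setD1 cw2.
  case=> /and4P[/noneP n1 e1 r1 /noneP n2] /andP[b2 /forallP e2].
  split; apply/andP; split => //.
  - apply/andP; split => //=; apply/noneP => c t cK t0 ts.
    have [->|cw2] := eqVneq c w2.
      by apply: (implyP (e2 t)); rewrite /A2 t0 -ltnS ts.
    by apply: n1; rewrite // in_setD1 cw2.
  - by apply/noneP => c t cK t0 ts; exact: n2.
  - apply/andP; split => //; apply/forallP => t; apply/implyP => tt.
    by apply: (implyP (e2 t)); rewrite /A2 tt orbT.
have dZ : depon (fun i => ~~ desc w2 i.1) Z.
  have dn (C : {set W}) lo hi : C \subset kids v :\ w2 -> depon (fun i => ~~ desc w2 i.1) (none C lo hi).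
    move=> /subsetP CK; apply: depon_sub (@depon_none _ _ _ _) => i /andP[/CK iK _].
    move: iK; rewrite in_setD1 => /andP[iw2 iv].
    by apply: contraNN iw2 => wi; apply/eqP; exact: kids_desc iv w2v wi.
  have CK : kids v :\ w :\ w2 \subset kids v :\ w2 by apply: setSD; exact: subD1set.
  apply: depon_and; first exact: dn.
  apply: depon_and; last (apply: depon_and; last exact: dn).
    apply: depon_sub (@depon_entered _ _ _) => i /andP[/eqP -> _].
    by apply: contraNN w2w => ww; rewrite (kids_desc wv w2v ww).
  apply: depon_sub (@depon_ret _ _ _ _ _ _ _ (fun o => o == Some z)) => i wi.
  apply: contraNN w2w => wi2; apply/eqP; apply: desc_inj wi2 wi.
  by rewrite (dep_kid wv) (dep_kid w2v).
have dE : depon (fun i => desc w2 i.1) (entered w2 s2 A2).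
  by apply: depon_sub (@depon_entered _ _ _) => i /andP[/eqP -> _]; exact: desc_refl.
have -> : Pr (fun a => kid_returns (w, s) z a && first_bar h (kids v :\ (w, s).1) (off z) w2 s2 a &&
                       (ret a n w2 (ordS s2) != None)) =
          Pr (fun a => Z a && (entered w2 s2 A2 a && (ret a n w2 (ordS s2) != None))).
  by apply: eq_Pr => a; rewrite E andbA.
rewrite (eq_Pr p E).
have dis (i : W * slot) : ~~ desc w2 i.1 -> ~~ desc w2 i.1 by [].
rewrite (Pr_indep2 p dis dZ); last first.
  exact: depon_and dE (@depon_ret _ _ _ _ _ _ _ (fun o => o != None)).
rewrite (Pr_indep2 p dis dZ dE) mulrCA ler_wpM2l ?Pr_ge0 //.
apply: IH => //; by rewrite /A2 negb_or ltnn andbF andbT negb_and -(ltnNge (off s)) (leq_ltn_trans sz zs2) orbT.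
Qed.

(** [ret_cases] is used twice: after [h], to find the first child [w] and its return slot [z], then
    after [z], where the next child may or may not be [w] again. *)
Lemma return_subset a : Y a -> ret a n.+1 v (ordS h) != None ->
  [|| parent_first a, no_early_kid a, late_bar a, no_second_kid a,
      parent_second a, first_kid_again a | second_kid_returns a].
Proof.
case r: (ret a n.+1 v (ordS h)) => [y|] // Ya _.
have o1 : off (ordS h) = 1%N by rewrite off_ordS off0 //; lia.
apply/or4P.
have [[s [s0 avs no]]|no|[w [s [z [wv s0 fb r1 r2]]]]] := ret_cases o1 r.
- by constructor 1; apply/existsP; exists s; rewrite s0 Ya avs.
- by constructor 2; apply: none_sub no => //; exact: leqW.
have [sL|sL] := leqP (off s) L; last first.
  by constructor 2; apply: none_sub (first_bar_none fb).
have q1 : early_entry (w, s) by rewrite /early_entry wv s0 sL.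
have awz := ret_bit r1.
have [zwin|] := boolP ((off z == 0) || (L < off z))%N.
  constructor 3; apply/existsP; exists (w, s); rewrite q1 /=.
  by apply/existsP; exists z; rewrite zwin fb.
rewrite negb_or -leqNgt -lt0n => /andP[z0 zL]; constructor 4.
(* The exit slot holds a bar of [w], and [s] holds the first such bar after offset 0. *)
have sz : (off s <= off z)%N.
  rewrite leqNgt; apply/negP => zs.
  by have /noneP/(_ w z wv z0 zs) := first_bar_none fb; rewrite awz.
have q2 : early_exit (w, s) z by rewrite /early_exit sz.
have Gz : kid_returns (w, s) z a by rewrite /kid_returns fb r1 /=.
have oz : off (ordS z) = (off z).+1 by apply: off_ordS; exact: leq_ltn_trans zL LK.
have n0 : n = n.-1.+1 by case: (n) r2.
rewrite n0 in r2; apply/or4P.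
have [[t [t0 avt no]]|no|[w2 [t [z2 [w2v t0 fb2 r3 _]]]]] := ret_cases oz r2.
- constructor 2; apply/existsP; exists (w, s); rewrite q1; apply/existsP; exists z.
  rewrite q2; apply/existsP; exists t; rewrite t0 Ya avt Gz /=.
  by apply: none_sub no => //; exact: subD1set.
- constructor 1; apply/existsP; exists (w, s); rewrite q1; apply/existsP; exists z.
  by rewrite q2 Gz /=; apply: none_sub no => //; exact: subD1set.
have [ww|ww] := eqVneq w2 w.
  constructor 3; apply/existsP; exists (w, s); rewrite q1; apply/existsP; exists z.
  rewrite q2; apply/existsP; exists t; rewrite t0 Gz /= -{1}ww (first_bar_bit fb2) /=.
  by apply: none_sub (first_bar_none fb2) => //; exact: subD1set.
constructor 4; apply/existsP; exists (w, s); rewrite q1; apply/existsP; exists z.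
rewrite q2; apply/existsP; exists (w2, t); rewrite Gz /= in_setD1 ww w2v t0 /=.
apply/andP; split; last by rewrite (ret_leq (leq_pred n) r3).
case/andP: fb2 => fb2 e2; rewrite /first_bar e2 andbT; apply: none_sub fb2 => //.
by apply: setSD; exact: subD1set.
Qed.

(** The two events that involve a parent bar were bounded jointly with [Y]; the other five read
    nothing on the edge above [v], so they are independent of [Y]. The sum of the bounds is
    [budget]. *)
Lemma Pr_return_step :
  Pr (fun a => Y a && (ret a n.+1 v (ordS h) != None)) <= 2^-1 * Pr Y.
Proof.
have dk (B : W * slot -> slot -> env -> bool) :
  (forall wx z, early_entry wx -> depon (fun i => i.1 != v) (B wx z)) ->
  depon (fun i => i.1 != v) (fun a => [exists wx, early_entry wx && [exists z, B wx z a]]).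
  move=> dB; apply: depon_exists => wx; case q1: (early_entry wx) => //=.
  by apply: depon_exists => z; exact: dB.
have dkid w lo hi : depon (fun i => i.1 != v) (none (kids v :\ w) lo hi).
  by apply: depon_none_kids; exact: subD1set.
have vkid w : w \in kids v -> w != v.
  by move=> wv; apply: contraTneq wv => ->; exact: v_notin_kids.
have dfb (C : {set W}) lo w s : w \in kids v -> C \subset kids v ->
    depon (fun i => i.1 != v) (first_bar h C lo w s).
  move=> wv CK; apply: depon_and.
    by apply: depon_none_kids; apply: subset_trans (subD1set _ _) CK.
  by apply: depon_sub (@depon_entered _ _ _) => i /andP[/eqP -> _]; exact: vkid.
have dret w s Q : w \in kids v -> depon (fun i => i.1 != v) (fun a : env => Q (ret a n w s)).
  move=> wv; apply: depon_sub (@depon_ret _ _ _ _ _ _ _ Q) => i wi.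
  by apply: contraTneq wi => ->; exact: desc_kidN wv.
have dbit w s : w \in kids v -> depon (fun i => i.1 != v) (fun a : env => a (w, s)).
  by move=> wv; apply: depon_sub (@depon_bit _ _) => i /eqP -> /=; exact: vkid.
have d2 : depon (fun i => i.1 != v) no_early_kid by exact: depon_none_kids.
have d3 : depon (fun i => i.1 != v) late_bar.
  apply: dk => wx z /andP[wv _]; apply: depon_and => //.
  by apply: depon_and; [exact: dfb|exact: dbit].
have dG wx z : early_entry wx -> depon (fun i => i.1 != v) (kid_returns wx z).
  by move=> /andP[wv _]; apply: depon_and; [exact: dfb|exact: dret].
have d4 : depon (fun i => i.1 != v) no_second_kid.
  apply: dk => wx z q1; apply: depon_and => //.
  by apply: depon_and; [exact: dG|exact: dkid].
have d6 : depon (fun i => i.1 != v) first_kid_again.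
  apply: dk => wx z q1; apply: depon_and => //; apply: depon_exists => s.
  apply: depon_and => //; apply: depon_and; last exact: dkid.
  by apply: depon_and; [exact: dG|apply: dbit; case/andP: q1].
have d7 : depon (fun i => i.1 != v) second_kid_returns.
  apply: dk => wx z q1; apply: depon_and => //; apply: depon_exists => -[w2 s2] /=.
  case E: (_ && _) => //=; have w2v : w2 \in kids v by case/andP: E; rewrite in_setD1 => /andP[].
  apply: depon_and; last exact: (dret _ _ (fun o => o != None) w2v).
  by apply: depon_and; [exact: dG|apply: dfb => //; exact: subD1set].
have sub a : Y a && (ret a n.+1 v (ordS h) != None) ->
    [|| parent_first a, parent_second a |
      Y a && [|| no_early_kid a, late_bar a, no_second_kid a, first_kid_again a | second_kid_returns a]].
  case/andP => Ya /(return_subset Ya); rewrite Ya.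
  by case: (parent_first a) => //=; case: (parent_second a) => //=; rewrite orFb.
have or5 : Pr (fun a => [|| no_early_kid a, late_bar a, no_second_kid a,
                            first_kid_again a | second_kid_returns a]) <=
    x ^+ L + ((K.+1 - L)%:R * p + (x ^+ (K - L) * 2^-1 + (gam * 2^-1 + 2^-1 * 2^-1))).
  apply: le_trans (Pr_or p_ge0 p_le1 _ _) (lerD Pr_no_early_kid _).
  apply: le_trans (Pr_or p_ge0 p_le1 _ _) (lerD Pr_late_bar _).
  apply: le_trans (Pr_or p_ge0 p_le1 _ _) (lerD Pr_no_second_kid _).
  exact: le_trans (Pr_or p_ge0 p_le1 _ _) (lerD Pr_first_kid_again Pr_second_kid_returns).
apply: le_trans (le_Pr p_ge0 p_le1 sub) _.
apply: le_trans (Pr_or p_ge0 p_le1 _ _) _.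
apply: le_trans (lerD Pr_parent_first (Pr_or p_ge0 p_le1 _ _)) _.
rewrite Pr_Y_indep; last first.
  by move=> a b ab; rewrite (d2 a b) // (d3 a b) // (d4 a b) // (d6 a b) // (d7 a b).
apply: le_trans (lerD (lexx _) (lerD Pr_parent_second (ler_wpM2l (Pr_ge0 p_ge0 p_le1 _) or5))) _.
apply: le_trans (ler_wpM2r (Pr_ge0 p_ge0 p_le1 Y) budget).
by rewrite le_eqVlt; apply/orP; left; apply/eqP; ring.
Qed.

End OneVertex.

(** Induction on the number of steps. Moving to a child costs one step and adds one to the depth, so
    [dep v + n <= M] is preserved and guarantees enough children wherever they are needed. *)
Lemma Pr_return n v (h : slot) A : (dep v + n <= M)%N -> ~~ A h ->
  Pr (fun a => entered v h A a && (ret a n v (ordS h) != None)) <= 2^-1 * Pr (entered v h A).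
Proof.
elim: n v h A => [|n IH] v h A vn Ah.
  rewrite (eq_Pr p (B := fun=> false)); last by move=> a; rewrite andbF.
  rewrite {1}/Pr big_pred0 // mulr_ge0 ?invr_ge0 ?ler0n //; exact: Pr_ge0.
apply: Pr_return_step => //; first by lia.
by move=> c s B cv Bs; apply: IH => //; have := dep_kid cv; lia.
Qed.

End ReturnProbability.

(** * The numerical inequality behind the bound 1/2 *)

Section Budget.
Variable R : realFieldType.

Lemma expr1Bn_le (p : R) n : 0 <= p -> p <= 1 -> (1 - p) ^+ n <= (1 + n%:R * p)^-1.
Proof.
move=> p0 p1; have n0 : 0 <= n%:R * p by rewrite mulr_ge0 ?ler0n.
rewrite -[leRHS]mul1r ler_pdivlMr; last by lra.
elim: n n0 => [|n IH] n0; first by rewrite expr0 mul0r addr0 mulr1.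
have n0' : 0 <= n%:R * p by rewrite mulr_ge0 ?ler0n.
apply: le_trans (IH n0'); rewrite exprS -mulrA [_ * (_ ^+ n * _)]mulrCA.
apply: ler_wpM2l; first by apply: exprn_ge0; lra.
rewrite -[n.+1%:R]natr1 !mulrDl mul1r.
have : 0 <= p * (n%:R * p) by rewrite mulr_ge0.
have : 0 <= p * p by rewrite mulr_ge0.
lra.
Qed.

(** The sum is at most [1 / (1 - x)], and [x <= 1 / (1 + k p)] turns [p / (1 - x)] into at most
    [(1 + k p) / k]. *)
Lemma geometric_le (p : R) k n : 0 < p -> p <= 1 -> (0 < k)%N ->
  p * \sum_(j < n) ((1 - p) ^+ k) ^+ j <= k%:R^-1 + p.
Proof.
move=> p0 p1 k0; set x := (1 - p) ^+ k.
have kR : 0 < k%:R :> R by rewrite ltr0n.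
have kp : 0 < k%:R * p by rewrite mulr_gt0.
have q0 : 0 <= 1 - p by lra.
have x0 : 0 <= x by rewrite exprn_ge0.
have xle : x * (1 + k%:R * p) <= 1.
  by rewrite -ler_pdivlMr ?mul1r ?expr1Bn_le //; lra.
have x1 : 0 < 1 - x by nra.
have sumE : (1 - x) * \sum_(j < n) x ^+ j <= 1.
  rewrite -opprB mulNr -subrX1 opprB; have := exprn_ge0 n x0; lra.
have S0 : 0 <= \sum_(j < n) x ^+ j by apply: sumr_ge0 => j _; exact: exprn_ge0.
set S := \sum_(j < n) _ in sumE S0 *.
have E : k%:R * p * S <= 1 + k%:R * p.
  apply: (@le_trans _ _ ((1 + k%:R * p) * ((1 - x) * S))).
    rewrite mulrA ler_wpM2r //; nra.
  by rewrite -[leRHS]mulr1 ler_wpM2l //; lra.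
rewrite -(ler_pM2l kR) mulrDr divff ?gt_eqF // mulrA; lra.
Qed.

(** With the estimates of the proof the left side stays below 0.47: about 0.027 for [gam], 0.003 for
    [x ^+ L], 0.077 for the late window and 0.363 for the halved bracket. *)
Lemma budget_exists (p : R) (d K : nat) : (39 <= d)%N -> 0 < p ->
  100 * d%:R * p <= 1 -> 420 <= d%:R * K.+1%:R * p ->
  exists2 L, (L < K)%N &
    let k := d.-1 in let x := (1 - p) ^+ k in let gam := k%:R^-1 + p in
    gam + x ^+ L + (K.+1 - L)%:R * p + 2^-1 * (x ^+ (K - L) + gam + gam + 2^-1) <= 2^-1.
Proof.
move=> d39 p0 dp dKp; set D := d%:R in dp dKp.
have D39 : 39 <= D by rewrite /D ler_nat.
have p1 : p <= 1 by nra.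
have pD : p * D <= 100^-1 by lra.
have psmall : p <= (39^-1 / 100) by nra.
(* The late window has [m = K - L] slots, the largest number with [m * p] at most [3 / d]. *)
pose Q m := m%:R * p * D <= 3.
have Q0 : exists m, Q m by exists 0%N; rewrite /Q !mul0r.
have QK m : Q m -> (m <= K)%N.
  rewrite /Q leqNgt => Qm; apply/negP => Km.
  have : K.+1%:R * (p * D) <= m%:R * (p * D) by rewrite ler_wpM2r ?ler_nat // mulr_ge0; lra.
  by move: Qm dKp; rewrite !mulrA; lra.
case: (ex_maxnP Q0 QK) => m Qm maxm.
have mS : 3 < m.+1%:R * p * D.
  by rewrite ltNge; apply/negP => /maxm; rewrite ltnn.
have mK := QK _ Qm.
set u := m%:R * p.
have u0 : 0 <= u by rewrite mulr_ge0 ?ler0n //; lra.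
have uD : u * D <= 3 by [].
have uD' : 3 - 100^-1 <= u * D by move: mS; rewrite -[m.+1%:R]natr1 !mulrDl mul1r -/u; lra.
have u1 : u <= 3 / 39 by nra.
have m0 : (0 < m)%N by rewrite lt0n; apply/eqP => m0; move: uD'; rewrite /u m0 !mul0r; lra.
exists (K - m)%N; first by rewrite ltn_subrL m0 (leq_trans m0).
move=> k x gam.
have kE : k%:R = D - 1 :> R by rewrite /k /D -{2}(@prednK d) -?[_.-1.+1%:R]natr1 ?addrK //; exact: leq_trans d39.
have gamle : gam <= 38^-1 + (39^-1 / 100).
  by rewrite /gam; apply: lerD => //; rewrite lef_pV2 ?posrE // ?kE; lra.
have q0 : 0 <= 1 - p by lra.
have q1 : 1 - p <= 1 by lra.
have -> : (K - (K - m) = m)%N by exact: subKn.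
have -> : (K.+1 - (K - m) = m.+1)%N by rewrite subSn ?leq_subr // subKn.
(* A substitute for [e^-3]. Applied directly, [expr1Bn_le] would give only about 1/4, which is too
   weak; applied to half the exponent, of mass at least 1.41, and then squared, it gives
   [2.41^-2]. *)
have xm : x ^+ m <= (241 / 100) ^- 2.
  rewrite /x -exprM.
  have half : (1 - p) ^+ (k * m) <= ((1 - p) ^+ (k./2 * m)) ^+ 2.
    by rewrite -exprM ler_wiXn2l // -mulnA [(m * 2)%N]mulnC mulnA leq_mul2r muln2 orbC; clear; lia.
  apply: le_trans half _; rewrite -exprVn; apply: lerXn2r; rewrite ?nnegrE ?exprn_ge0 //; first by lra.
  apply: le_trans (expr1Bn_le _ (ltW p0) p1) _.
  have k2 : D - 2 <= 2 * (k./2)%:R.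
    have : (d - 2 <= 2 * k./2)%N by rewrite /k; clear -d39; lia.
    by rewrite -(ler_nat R) natrM natrB; [|exact: leq_trans d39].
  have mp : 141 / 100 <= (k./2 * m)%:R * p by rewrite natrM -mulrA -/u; nra.
  by rewrite lef_pV2 ?posrE; lra.
(* The mass 420 of a full round still leaves 400 after the late window and one child are taken
   away. *)
have xL : x ^+ (K - m) <= 400^-1.
  rewrite /x -exprM; apply: le_trans (expr1Bn_le _ (ltW p0) p1) _.
  have LE : (k * (K - m))%:R * p = (D - 1) * (K.+1%:R * p - p - u).
    by rewrite natrM kE natrB // -[K.+1%:R]natr1 /u; ring.
  have : 400 <= (k * (K - m))%:R * p.
    have KD : 420 <= D * (K.+1%:R * p) by rewrite mulrA.
    rewrite LE; set y := K.+1%:R * p in KD *.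
    have -> : (D - 1) * (y - p - u) = (1 - D^-1) * (D * y - p * D - u * D).
      by field; lra.
    have : D^-1 <= 39^-1 by rewrite lef_pV2 ?posrE; lra.
    nra.
  by move=> H; rewrite lef_pV2 ?posrE; lra.
have : m.+1%:R * p = u + p by rewrite -[m.+1%:R]natr1 mulrDl mul1r.
move=> ->; move: xm; rewrite -exprVn => xm; lra.
Qed.

End Budget.

(** * Closing the loop with an artificial bar *)

Section Phantom.
Variables (R : realFieldType) (W : finType) (par : W -> W) (dep : W -> nat).
Variables (K M d : nat) (p : R).
Local Notation slot := 'I_K.+1.
Local Notation env := {ffun W * 'I_K.+1 -> bool}.
Local Notation kids := (kids par dep).
Local Notation desc := (desc par dep).
Local Notation ret := (@ret W par dep K).
Local Notation Pr := (@Pr R (W * 'I_K.+1)%type p).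
Hypotheses (d39 : (39 <= d)%N) (p_gt0 : 0 < p).
Hypotheses (p_small : 100 * d%:R * p <= 1) (K_large : 420 <= d%:R * K.+1%:R * p).
Hypothesis many_kids : forall v, (dep v < M)%N -> (d <= #|kids v|)%N.

Definition set_bit (i : W * slot) (a : env) : env := [ffun j => (j == i) || a j].

(* An artificial bar in slot [h] of the edge above [v] closes the loop of the
   walk started on the pole of [v] just after [h]. *)
Definition comes_back n (h : slot) v (a : env) :=
  ret (set_bit (v, h) a) n v (ordS h) != None.

Lemma depon_comes_back n h v : depon (fun i => desc v i.1) (comes_back n h v).
Proof.
move=> a b ab; rewrite /comes_back (@eq_ret _ _ _ _ _ (set_bit (v, h) b)) // => w t vw.
by rewrite !ffunE ab.
Qed.

Let p_ge0 : 0 <= p. Proof. exact: ltW. Qed.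
Let p_le1 : p <= 1.
Proof.
have : (39 : R) * p <= d%:R * p by rewrite ler_wpM2r // ler_nat.
move: p_small p_ge0; lra.
Qed.

(** With a true bar in slot [h] and no further history, [Pr_return] gives [p / 2]. The artificial
    bar makes the event independent of that bit, so [p] can be divided out. *)
Lemma Pr_comes_back n h v : (dep v + n <= M)%N -> Pr (comes_back n h v) <= 2^-1.
Proof.
move=> vM; have [L LK bud] := budget_exists d39 p_gt0 p_small K_large.
have kids_lt u : (dep u < M)%N -> (d.-1 < #|kids u|)%N by move=> /many_kids; apply: leq_trans; rewrite prednK // (leq_trans _ d39).
have geo m : p * \sum_(j < m) ((1 - p) ^+ d.-1) ^+ j <= d.-1%:R^-1 + p.
  by apply: geometric_le; rewrite ?ltn_predRL ?(leq_trans _ d39).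
have := Pr_return p_ge0 p_le1 LK kids_lt geo bud vM (isT : ~~ (fun=> false) h).
have entE a : entered v h (fun=> false) a = a (v, h).
  by rewrite /entered; case: (a _) => //=; apply/forallP.
rewrite (eq_Pr p entE) Pr_bit.
rewrite (eq_Pr p (B := fun a => a (v, h) && comes_back n h v a)); last first.
  move=> a; rewrite entE; case avh: (a (v, h)) => //=; rewrite /comes_back.
  congr (ret _ _ _ _ != _); apply/ffunP => i; rewrite ffunE.
  by case: eqP => // ->; rewrite avh.
rewrite (Pr_indep p (@depon_bit _ (v, h))).
  by rewrite Pr_bit mulrC ler_pM2r.
move=> a b ab; rewrite /comes_back; congr (ret _ _ _ _ != _); apply/ffunP => i.
by rewrite !ffunE; case: eqVneq => //= ih; apply: ab.
Qed.

(** Distinct vertices of equal depth have disjoint subtrees, so the events are independent. *)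
Lemma Pr_all_come_back (B : finType) (vs : B -> W) n h m0 : injective vs ->
  (forall b, dep (vs b) = m0) -> (m0 + n <= M)%N ->
  Pr (fun a => [forall b, comes_back n h (vs b) a]) <= 2^-1 ^+ #|B|.
Proof.
move=> vs_inj vsm m0n; rewrite cardE.
rewrite (eq_Pr p (B := fun a => all (fun b => comes_back n h (vs b) a) (enum B))); last first.
  move=> a; apply/forallP/allP => [H b _|H b]; first exact: H.
  by apply: H; rewrite mem_enum.
elim: (enum B) (enum_uniq B) => [|b s IH] /=; first by rewrite Pr_le1.
case/andP => bs /IH{}IH; rewrite exprS.
have dall : depon (fun i => ~~ desc (vs b) i.1)
    (fun a => all (fun b => comes_back n h (vs b) a) s).
  move=> a a' aa'; apply: eq_in_all => b' b's; apply: depon_comes_back => i bi.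
  apply: aa'; apply: contraNN bs => bi'.
  by rewrite (vs_inj _ _ (desc_inj (etrans (vsm b) (esym (vsm b'))) bi' bi)).
rewrite (Pr_indep p (@depon_comes_back n h (vs b)) dall).
by apply: ler_pM; rewrite ?Pr_ge0 // Pr_comes_back // vsm.
Qed.

End Phantom.

From mathcomp Require Import all_classical all_reals all_analysis.
Local Open Scope classical_set_scope.
Local Open Scope ring_scope.

(** * From Poisson processes to bits *)

Section SlotBits.
Variables (R : realType) (dm : measure_display) (Omega : measurableType dm).
Variables (P : probability Omega R) (V : Type) (root : V).
Variables (N : V -> Omega -> set R) (T : R).
Hypotheses (T_gt0 : 0 < T) (poissonN : indep_poisson_family P root N).

Definition grid (K j : nat) : R := T * j%:R / K.+1%:R.

Definition rings (K : nat) (w : V) (j : nat) (om : Omega) : bool :=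
  `[< exists t, N w om t /\ grid K j < t <= grid K j.+1 >].

(** The probability that a rate-one Poisson process has a point in a slot of length [T / K.+1]. *)
Definition pbit (K : nat) : R := 1 - expR (- (T / K.+1%:R)).

Lemma grid_le K i j : (i <= j)%N -> grid K i <= grid K j.
Proof. by move=> ij; rewrite /grid ler_wpM2r ?invr_ge0 // ler_wpM2l ?ler_nat // ltW. Qed.

Lemma grid0 K : grid K 0 = 0. Proof. by rewrite /grid mulr0 mul0r. Qed.

Lemma gridT K : grid K K.+1 = T. Proof. by rewrite /grid mulfK // pnatr_eq0. Qed.

Lemma gridS K j : grid K j.+1 - grid K j = T / K.+1%:R.
Proof. by rewrite /grid -mulrBl -mulrBr -natr1 addrAC subrr add0r mulr1. Qed.

Lemma pbit_ge0 K : 0 <= pbit K.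
Proof. by rewrite subr_ge0 -expR0 ler_expR oppr_le0 divr_ge0 // ltW. Qed.

Lemma pbit_le1 K : pbit K <= 1.
Proof. by rewrite /pbit gerBl expR_ge0. Qed.

Lemma has_card0 (U : Type) (A : set U) : has_card A 0 <-> A = set0.
Proof.
split=> [[f [_ <-]]|->]; first by rewrite -subset0 => x [[]].
have f : 'I_0 -> U by case.
by exists f; split; [case | rewrite -subset0 => x [[]]].
Qed.

Variables (W : finType) (es : W -> V) (K : nat).
Hypotheses (es_inj : injective es) (es_root : forall w, es w <> root).
Local Notation coord := (W * 'I_K.+1)%type.

Definition bits (om : Omega) : {ffun coord -> bool} :=
  [ffun i : coord => rings K (es i.1) i.2 om].

(** The Poisson hypothesis with all counts equal to 0 gives the joint void probabilities, which
    determine the law of the bits. *)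
Lemma void_prob (Z : {set coord}) :
  measurable [set om | forall i, i \in Z -> ~~ bits om i] /\
  P [set om | forall i, i \in Z -> ~~ bits om i] = ((1 - pbit K) ^+ #|Z|)%:E.
Proof.
pose c (j : 'I_#|Z|) : coord := enum_val j.
have hyp1 j : es (c j).1 <> root /\ 0 <= grid K (c j).2 /\
    grid K (c j).2 <= grid K (c j).2.+1.
  by split => //; split; [rewrite -(grid0 K)|]; apply: grid_le.
have hyp2 i j : i != j -> es (c i).1 = es (c j).1 ->
    grid K (c i).2.+1 <= grid K (c j).2 \/ grid K (c j).2.+1 <= grid K (c i).2.
  move=> ij /es_inj c1.
  have c2 : val (c i).2 <> val (c j).2.
    move=> /val_inj c2; case/eqP: ij; apply: enum_val_inj.
    by move: c1 c2; rewrite -/(c i) -/(c j); case: (c i) (c j) => ? ? [? ?] /= -> ->.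
  by have [c3|c3|//] := ltngtP (val (c i).2) (val (c j).2); [left|right]; apply: grid_le.
have := poissonN (fun=> 0%N) hyp1 hyp2; cbv zeta.
set E := [set om | forall j, has_card _ _].
have -> : [set om | forall i, i \in Z -> ~~ bits om i] = E.
  apply/seteqP; split => om /= H.
    move=> j; apply/has_card0; rewrite -subset0 => t [Nt [t1 t2]].
    have := H (c j) (enum_valP j); rewrite ffunE => /asboolP; apply.
    by exists t; rewrite t1 t2.
  move=> i iZ; have := H (enum_rank_in iZ i); rewrite /c enum_rankK_in // has_card0 => H0.
  rewrite ffunE; apply/asboolP => -[t [Nt /andP[t1 t2]]].
  by have : set0 t by rewrite -H0.
move=> [mE ->]; split => //; congr EFin.
rewrite (eq_bigr (fun=> 1 - pbit K)); first by rewrite prodr_const card_ord.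
move=> j _; rewrite /Defs.poisson_prob /= gridS expr0 fact0 mulr1 divr1 /pbit.
by rewrite opprB addrC subrK.
Qed.

(** Induction on [O]: requiring a bit to be set is the difference between requiring nothing of it
    and requiring it to be clear. *)
Lemma mixed_prob (O Z : seq coord) :
  measurable [set om | all (bits om) O && all (predC (bits om)) Z] /\
  P [set om | all (bits om) O && all (predC (bits om)) Z] =
    (Pr (pbit K) (fun a => all a O && all (predC a) Z))%:E.
Proof.
elim: O Z => [|i O IH] Z /=.
  have -> : [set om | all (predC (bits om)) Z] =
      [set om | forall i, i \in [set i in Z]%SET -> ~~ bits om i].
    apply/seteqP; split => om /= H => [i|]; first by rewrite inE => /(allP H).
    by apply/allP => i iZ; apply: H; rewrite inE.
  have [mV ->] := void_prob [set i in Z]%SET; split => //; congr EFin.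
  rewrite (eq_Pr _ (B := fun a => [forall i, (i \in Z) ==> ~~ a i])).
    by rewrite Pr_zero; congr (_ ^+ _); apply: eq_card => i; rewrite !inE.
  move=> a; apply/allP/forallP => H j; first exact/implyP/H.
  exact/implyP/H.
have [m1 P1] := IH Z; have [m2 P2] := IH (i :: Z).
have -> : [set om | bits om i && all (bits om) O && all (predC (bits om)) Z] =
    [set om | all (bits om) O && all (predC (bits om)) Z] `\`
    [set om | all (bits om) O && all (predC (bits om)) (i :: Z)].
  apply/seteqP; split => om /=.
    by move=> /andP[/andP[bi ->] ->]; split => //; rewrite bi.
  by move=> [/andP[-> ->]] /negP; rewrite !andbT /= negbK.
split; first exact: measurableD.
have ltoo : (P [set om | all (bits om) O && all (predC (bits om)) Z] < +oo)%E.
  by rewrite P1 ltry.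
rewrite (measureD m1 m2 ltoo) setIidr; last by move=> om /= /and3P[-> _ ->].
transitivity (P [set om | all (bits om) O && all (predC (bits om)) Z] -
  P [set om | all (bits om) O && all (predC (bits om)) (i :: Z)])%E; first by [].
rewrite P1 P2 -EFinB; congr EFin; apply/eqP; rewrite subr_eq; apply/eqP.
rewrite /Pr (bigID (fun a : {ffun coord -> bool} => a i)) /=.
by congr +%R; apply: eq_bigl => a; case: (a i); rewrite /= ?andbT ?andbF.
Qed.

Lemma cube_event (A : {ffun coord -> bool} -> bool) :
  measurable [set om | A (bits om)] /\
  (P [set om | A (bits om)] <= (Pr (pbit K) A)%:E)%E.
Proof.
have cellE a : [set om | bits om = a] =
    [set om | all (bits om) [seq i <- enum {: coord} | a i] &&
              all (predC (bits om)) [seq i <- enum {: coord} | ~~ a i]].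
  apply/seteqP; split => om /=.
    by move=> ->; apply/andP; split; apply/allP => i; rewrite mem_filter => /andP[].
  move=> /andP[/allP H1 /allP H2]; apply/ffunP => i; apply/idP/idP => [bi|ai].
    by apply: contraTT bi => ai; apply: H2; rewrite mem_filter ai mem_enum.
  by apply: H1; rewrite mem_filter ai mem_enum.
have cell a : measurable [set om | bits om = a] /\
    P [set om | bits om = a] = (cube_wt (pbit K) a)%:E.
  rewrite cellE; have [m ->] := mixed_prob [seq i <- enum {: coord} | a i]
    [seq i <- enum {: coord} | ~~ a i].
  split => //; congr EFin.
  rewrite (eq_Pr _ (B := pred1 a)); first by rewrite /Pr big_pred1_eq.
  move=> b /=; apply/andP/eqP => [[/allP H1 /allP H2]|->].
    apply/ffunP => i; apply/idP/idP => [bi|ai].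
      by apply: contraTT bi => ai; apply: H2; rewrite mem_filter ai mem_enum.
    by apply: H1; rewrite mem_filter ai mem_enum.
  by split; apply/allP => i; rewrite mem_filter => /andP[].
have seqE (s : seq {ffun coord -> bool}) : measurable [set om | bits om \in s] /\
    (P [set om | bits om \in s] <= (\sum_(a <- s) cube_wt (pbit K) a)%:E)%E.
  elim: s => [|a s [ms Ps]].
    rewrite big_nil (_ : [set om | _] = set0); first by rewrite measure0.
    by rewrite -subset0 => om.
  have [ma Pa] := cell a.
  have -> : [set om | bits om \in a :: s] = [set om | bits om = a] `|` [set om | bits om \in s].
    apply/seteqP; split => om /=; rewrite in_cons; first by case/orP => [/eqP|]; [left|right].
    by case=> [->|->]; rewrite ?eqxx ?orbT.
  split; first exact: measurableU.
  apply: (@le_trans _ _ (P [set om | bits om = a] + P [set om | bits om \in s])%E).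
    exact: measureU2.
  by rewrite big_cons EFinD Pa leeD2l.
have [m Pm] := seqE [seq a <- enum {: {ffun coord -> bool}} | A a].
have -> : [set om | A (bits om)] =
    [set om | bits om \in [seq a <- enum {: {ffun coord -> bool}} | A a]].
  by apply/seteqP; split => om /=; rewrite mem_filter mem_enum andbT.
split => //; apply: le_trans Pm _.
by rewrite big_filter /Pr big_enum_cond.
Qed.

End SlotBits.

(** * Outer bounds for events not known to be measurable *)

Section OuterBound.
Variables (R : realType) (dm : measure_display) (Omega : measurableType dm).
Variable P : probability Omega R.

Definition outer_le (S : set Omega) (x : R) :=
  exists U, [/\ measurable U, S `<=` U & (P U <= x%:E)%E].

Lemma outer_le_liminf (S : set Omega) (x : R) (E : nat -> set Omega) (K0 : nat) :
  (forall K, (K0 <= K)%N -> measurable (E K) /\ (P (E K) <= x%:E)%E) ->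
  (forall om, S om -> exists j, forall K, (j <= K)%N -> E K om) ->
  outer_le S x.
Proof.
move=> mE SE; pose F j := \bigcap_(K in [set K | (maxn j K0 <= K)%N]) E K.
have mF j : measurable (F j).
  by apply: bigcap_measurable => [|K /= jK]; [exists (maxn j K0) => /=|apply: (mE _ _).1; lia].
have ndF : nondecreasing_seq F.
  by move=> i j ij; apply/subsetPset => om Fi K /= jK; apply: Fi => /=; lia.
have mU : measurable (\bigcup_j F j) by exact: bigcupT_measurable.
exists (\bigcup_j F j); split => //.
  by move=> om /SE[j Ej]; exists j => // K /= jK; apply: Ej; lia.
have cvgF := @nondecreasing_cvg_mu _ _ _ P _ mF mU ndF.
rewrite -(cvg_lim _ cvgF) //; apply: lime_le; first by apply/cvg_ex; eexists; exact: cvgF.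
apply: nearW => j /=; have [mEj PEj] := mE (maxn j K0) (leq_maxr _ _).
by apply: le_trans PEj; apply: le_measure; rewrite ?inE // => om; apply => /=.
Qed.

Lemma outer_leW (S : set Omega) x y : x <= y -> outer_le S x -> outer_le S y.
Proof.
move=> xy [U [mU SU PU]]; exists U; split => //.
by rewrite (le_trans PU) ?lee_fin.
Qed.

Lemma outer_le_seq (I : eqType) (s : seq I) (S : I -> set Omega) x :
  (forall i, i \in s -> outer_le (S i) x) ->
  outer_le [set om | exists2 i, i \in s & S i om] ((size s)%:R * x).
Proof.
elim: s => [|i s IH] Ss /=.
  exists set0; split; rewrite ?measure0 ?mul0r //.
  by move=> om [].
have [U1 [m1 S1 P1]] := Ss i (mem_head _ _).
have [j js|U2 [m2 S2 P2]] := IH; first by apply: Ss; rewrite in_cons js orbT.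
exists (U1 `|` U2); split; first exact: measurableU.
  move=> om [j]; rewrite in_cons => /orP[/eqP -> /S1|js Sj]; [by left|right].
  by apply: S2; exists j.
apply: (@le_trans _ _ (P U1 + P U2)%E); first exact: measureU2.
by rewrite -natr1 mulrDl mul1r addrC EFinD leeD.
Qed.

Lemma outer_le_negligible (S : set Omega) :
  (forall e : R, 0 < e -> outer_le S e) -> P.-negligible S.
Proof.
move=> Se.
have /choice[U HU] : forall n : nat, exists U,
    [/\ measurable U, S `<=` U & (P U <= (n.+1%:R^-1)%:E)%E].
  by move=> n; apply: Se; rewrite invr_gt0.
have mU : measurable (\bigcap_n U n).
  by apply: bigcapT_measurable => n; have [] := HU n.
exists (\bigcap_n U n); split => //; last by move=> om So n _; have [_ + _] := HU n; apply.
apply/eqP; rewrite eq_le measure_ge0 andbT; apply/lee_addgt0Pr => e e0.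
rewrite add0e; have [n ne] : exists n : nat, n.+1%:R^-1 < e.
  exists (Num.truncn e^-1); rewrite -[ltRHS]invrK ltf_pV2 ?posrE ?invr_gt0 //.
  exact: truncnS_gt.
have [mUn _ PUn] := HU n; apply: le_trans (le_trans _ PUn) _; last by rewrite lee_fin ltW.
by apply: le_measure; rewrite ?inE // => om; apply.
Qed.

End OuterBound.

(** * Rooted trees *)

Section Tree.
Variables (V : choiceType) (root : V) (par : V -> V).
Hypothesis tree : rooted_tree root par.

Lemma reach_root v : exists n, iter n par v == root.
Proof. by have [_ [_ /(_ v)[n nv]]] := tree; exists n; apply/eqP. Qed.

Definition depth v : nat := ex_minn (reach_root v).

Lemma depth_root : depth root = 0%N.
Proof. by rewrite /depth; case: ex_minnP => n _ /(_ 0%N); rewrite eqxx => /(_ isT); case: n. Qed.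

Lemma depth0 v : depth v = 0%N -> v = root.
Proof. by rewrite /depth; case: ex_minnP => n /eqP nv _ n0; rewrite -nv n0. Qed.

Lemma depth_par v : v <> root -> depth v = (depth (par v)).+1.
Proof.
rewrite /depth; case: ex_minnP => n nv nmin; case: ex_minnP => m mv mmin vr.
case: n nv nmin => [/eqP|n]; first by [].
rewrite iterSr => /mmin mn nmin; apply/eqP; rewrite eqSS eqn_leq mn andbT -ltnS.
by apply: nmin; rewrite iterSr.
Qed.

Lemma depth_gt0 v : v <> root -> (0 < depth v)%N.
Proof. by move=> /depth_par ->. Qed.

Lemma depth_offspring v w : offspring root par v w -> depth w = (depth v).+1.
Proof. by case=> /depth_par -> ->. Qed.

Lemma offspring_list : bounded_degree root par -> exists (D : nat) (ks : V -> seq V),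
  forall v, [/\ uniq (ks v), (size (ks v) <= D)%N &
             forall w, (w \in ks v) <-> offspring root par v w].
Proof.
case=> D HD; exists D.
suff /choice[ks Hks] : forall v, exists s, [/\ uniq s, (size s <= D)%N &
    forall w, (w \in s) <-> offspring root par v w] by exists ks.
move=> v.
have sz (s : seq V) : uniq s -> (forall w, w \in s -> offspring root par v w) ->
    (size s <= D)%N.
  move=> us sv; apply: (HD v _ (fun i : 'I_(size s) => nth root s i)).
    by move=> i j /eqP; rewrite nth_uniq // => /eqP/val_inj.
  by move=> i; apply: sv; rewrite mem_nth.
have : finite_set (offspring root par v).
  apply: contrapT => /(infinite_set_fset D.+1)[B BA DB].
  by have := sz _ (finmap.fset_uniq B) (fun w wB => BA w wB); rewrite leqNgt DB.
move/finite_seqP => [s As]; exists (undup s).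
have memE w : (w \in undup s) <-> offspring root par v w by rewrite mem_undup As.
by split; rewrite ?undup_uniq //; apply: sz => [|w /memE //]; exact: undup_uniq.
Qed.

Variables (D : nat) (ks : V -> seq V).
Hypothesis ksP : forall v, [/\ uniq (ks v), (size (ks v) <= D)%N &
             forall w, (w \in ks v) <-> offspring root par v w].

Fixpoint level (j : nat) : seq V :=
  if j is j.+1 then flatten [seq ks v | v <- level j] else [:: root].

Lemma mem_level j v : (v \in level j) = (depth v == j).
Proof.
elim: j v => [|j IH] v /=.
  rewrite inE; apply/eqP/eqP => [->|]; [exact: depth_root|exact: depth0].
apply/flatten_mapP/eqP => [[u]|dv].
  rewrite IH => /eqP <-; have [_ _ kE] := ksP u.
  by move=> /kE /depth_offspring.
have vr : v <> root by move=> vr; move: dv; rewrite vr depth_root.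
exists (par v); first by rewrite IH -eqSS -depth_par // dv.
by have [_ _ kE] := ksP (par v); apply/kE.
Qed.

(** Levels start at 1 because the elements stand for edges, named by their lower endpoints; the root
    names no edge. *)
Definition tree_ball (M : nat) : seq V := flatten [seq level j | j <- iota 1 M].

Lemma mem_tree_ball M v : (v \in tree_ball M) = (0 < depth v <= M)%N.
Proof.
apply/flatten_mapP/idP => [[j]|dv].
  by rewrite mem_iota add1n ltnS mem_level => jM /eqP ->.
by exists (depth v); rewrite ?mem_level // mem_iota add1n ltnS.
Qed.

Section Ball.
Variable M : nat.
Local Notation W := (seq_sub (tree_ball M)).

(** A child of the root has its parent outside the ball, and [insubd] then returns [w] itself; the
    depth test in [kids] rules this out. *)
Definition parW (w : W) : W := insubd w (par (val w)).
Definition depW (w : W) : nat := depth (val w).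
Local Notation kids := (kids parW depW).

Lemma depW_bounds (w : W) : (0 < depW w <= M)%N.
Proof. by rewrite -mem_tree_ball; exact: valP. Qed.

Lemma val_root (w : W) : val w <> root.
Proof. by move=> wr; have := depW_bounds w; rewrite /depW wr depth_root. Qed.

Lemma kidsP (v c : W) : c \in kids v <-> offspring root par (val v) (val c).
Proof.
rewrite inE; split.
  move=> /andP[/eqP pc /eqP dc]; split; first exact: val_root.
  rewrite -pc /parW val_insubd mem_tree_ball ifT //.
  have := depth_par (@val_root c); rewrite -/(depW c) dc => -[dp].
  by rewrite -dp -/(depW v) depW_bounds.
move=> cv; have dc := depth_offspring cv; case: cv => cr pc; apply/andP; split.
  by apply/eqP/val_inj; rewrite /parW val_insubd pc ifT //; exact: valP.
by apply/eqP.
Qed.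

Lemma card_kids d (v : W) : min_offspring root par d -> (depW v < M)%N ->
  (d <= #|kids v|)%N.
Proof.
move=> /(_ (val v))[f [f_inj fv]] vM; rewrite -[d]card_ord.
pose g i : W := insubd v (f i).
have gE i : val (g i) = f i.
  by rewrite val_insubd mem_tree_ball (depth_offspring (fv i)) /= vM.
have g_inj : injective g by move=> i j /(congr1 val); rewrite !gE => /f_inj.
rewrite -(card_imset _ g_inj); apply: subset_leq_card; apply/fintype.subsetP => _ /imsetP[i _ ->].
by apply/kidsP; rewrite gE.
Qed.

End Ball.

(** Two of the [d] offspring are kept at each vertex. The head of a word is the last choice made, so
    its tail addresses the parent. *)
Lemma binary_words d : (1 < d)%N -> min_offspring root par d ->
  exists g : seq bool -> V, (forall l, depth (g l) = size l) /\
    (forall l l', size l = size l' -> g l = g l' -> l = l').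
Proof.
move=> d1 /choice[f Hf]; pose i0 := Ordinal (ltnW d1); pose i1 := Ordinal d1.
pose fix g (l : seq bool) : V :=
  if l is b :: l then f (g l) (if b then i1 else i0) else root.
exists g; split.
  elim=> [|b l IH] /=; first exact: depth_root.
  by have [_ /(_ (if b then i1 else i0)) /depth_offspring ->] := Hf (g l); rewrite IH.
elim=> [|b l IH] [|b' l'] //= [sl] gg.
have ll' : l = l'.
  apply: IH => //.
  have [_ /(_ (if b then i1 else i0)) [_ <-]] := Hf (g l).
  by have [_ /(_ (if b' then i1 else i0)) [_ <-]] := Hf (g l'); rewrite gg.
move: gg; rewrite ll'; have [f_inj _] := Hf (g l') => /f_inj.
by case: b b' {f_inj} => [] [].
Qed.

End Tree.

(** * Trajectories and slot walks *)

Section Trajectories.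
Variables (R : realType) (V : choiceType) (root : V) (par : V -> V).
Hypothesis tree : rooted_tree root par.
Variables (dm : measure_display) (Omega : measurableType dm).
Variables (N : V -> Omega -> set R) (T : R) (om : Omega).
Hypothesis T_gt0 : 0 < T.
Local Notation depth := (depth tree).
Local Notation incident := (incident root par).
Local Notation crosses := (crosses root par).
Local Notation grid := (grid T).
Local Notation rings K w j := (rings N T K w j om).

(** An inductive form of [stir] that also bounds the depth of the vertices visited, so that finitely
    many edges matter. *)
Inductive travel (M : nat) : R -> V -> V -> Prop :=
| travel_stay t x of (depth x < M)%N &
    (forall w s, incident x w -> t < s -> s <= T -> ~ N w om s) : travel M t x x
| travel_jump t x w y t' u of (depth x < M)%N & crosses x w y & N w om t' &
    t < t' & t' <= T &
    (forall w s, incident x w -> t < s -> s < t' -> ~ N w om s) &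
    travel M t' y u : travel M t x u.

Lemma travel_leq M M' t x u : (M <= M')%N -> travel M t x u -> travel M' t x u.
Proof.
move=> MM; elim=> {t x u} [t x xM H|t x w y t' u xM c Nw tt' tT H _ IH].
  by apply: travel_stay => //; exact: leq_trans MM.
by apply: (travel_jump _ c Nw) => //; exact: leq_trans MM.
Qed.

Lemma travel_stir M v u : travel M 0 v u -> stir root par (fun w => N w om) T v u.
Proof.
move=> tr.
suff [k [ts [xs [[x0 xk t0 tk] [H1 [H2 H3]]]]]] : exists k (ts : nat -> R) (xs : nat -> V),
    [/\ xs 0%N = v, xs k = u, ts 0%N = 0 & ts k <= T] /\
     (forall i, (i < k)%N -> ts i < ts i.+1) /\
     (forall i, (i < k)%N ->
        exists w, crosses (xs i) w (xs i.+1) /\ N w om (ts i.+1)) /\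
     (forall i w t, (i <= k)%N -> incident (xs i) w ->
        ts i < t -> ((i < k)%N -> t < ts i.+1) -> ((k <= i)%N -> t <= T) ->
        ~ N w om t).
  by exists k, ts, xs.
have : 0 <= T by exact: ltW.
elim: tr => {v u} [t x _ H|t x w y t' u _ c Nw tt' tT H _ IH] t0T.
  exists 0%N, (fun=> t), (fun=> x); split => //; split => //; split => //.
  by move=> i w s _ xw ts _ sT; apply: H xw ts (sT _).
have [k [ts [xs [[x0 xk t0 tk] [H1 [H2 H3]]]]]] := IH tT.
exists k.+1, (fun i => if i is i.+1 then ts i else t), (fun i => if i is i.+1 then xs i else x).
split => //; split; first by case=> [|i] ik; [rewrite t0|exact: H1].
split.
  case=> [|i] ik; last exact: H2.
  by exists w; rewrite x0 t0.
case=> [|i] w' s ik xw ts' s1 s2; last exact: H3 xw ts' s1 s2.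
by apply: H xw ts' _; rewrite -t0; exact: s1.
Qed.

Lemma slot_of K t : 0 < t -> t <= T -> exists2 j, (j <= K)%N & grid K j < t <= grid K j.+1.
Proof.
move=> t0 tT; have ex : exists j, t <= grid K j.+1 by exists K; rewrite gridT.
case: (ex_minnP ex) => j tj jmin; exists j; first by apply: jmin; rewrite gridT.
rewrite tj andbT; case: j tj jmin => [|j] tj jmin; first by rewrite grid0.
by rewrite ltNge; apply/negP => /jmin; rewrite ltnn.
Qed.

(** At most one ring per slot makes the slot walk follow the true order of the rings. The second
    clause keeps slot 0, where the artificial bar is placed, free of rings. *)
Definition sparse (M K : nat) :=
  (forall w w' t t' j, w <> root -> w' <> root -> (depth w <= M)%N -> (depth w' <= M)%N ->
     (j <= K)%N -> N w om t -> N w' om t' -> grid K j < t <= grid K j.+1 ->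
     grid K j < t' <= grid K j.+1 -> w = w' /\ t = t') /\
  (forall w t, w <> root -> (depth w <= M)%N -> N w om t -> 0 < t -> grid K 1 < t).

Definition slot_step (K j : nat) (x y : V) :=
  (y = x /\ forall w, incident x w -> ~~ rings K w j) \/
  (exists w, crosses x w y /\ rings K w j).

(** [i] is reduced modulo [K.+1] only when a slot is read, so that walks over several rounds can be
    concatenated. *)
Fixpoint walk (M K n i : nat) (x y : V) : Prop :=
  (depth x < M)%N /\
  if n is n.+1 then exists z, slot_step K (i %% K.+1) x z /\ walk M K n i.+1 z y else x = y.

Lemma walk_depth M K n i x y : walk M K n i x y -> (depth x < M)%N.
Proof. by case: n => [|n] []. Qed.

Lemma walk_cat M K n m i x y z : walk M K n i x y -> walk M K m (i + n) y z ->
  walk M K (n + m) i x z.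
Proof.
elim: n i x => [|n IH] i x /=; first by rewrite addn0 => -[_ ->].
move=> [xM [u [xu uy]]] yz; split => //; exists u; split => //.
by apply: IH uy _; rewrite addSnnS.
Qed.

Lemma walk_shift M K n i x y : walk M K n i x y -> walk M K n (i + K.+1) x y.
Proof.
elim: n i x => [//|n IH] i x /= [xM [z [xz zy]]]; split => //; exists z; split.
  by rewrite modnDr.
by rewrite -addSn; exact: IH.
Qed.

Lemma walk_shifts M K n i c x y : walk M K n i x y -> walk M K n (i + c * K.+1) x y.
Proof.
elim: c => [|c IH] H; first by rewrite mul0n addn0.
by have := walk_shift (IH H); rewrite -addnA -mulSnr.
Qed.

Lemma rings_of K w t j : N w om t -> grid K j < t <= grid K j.+1 -> rings K w j.
Proof. by move=> Nw tj; apply/asboolP; exists t. Qed.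

Lemma incident_root x w : incident x w -> w <> root.
Proof. by case. Qed.

Lemma incident_depth M x w : (depth x < M)%N -> incident x w -> (depth w <= M)%N.
Proof.
move=> xM [wr [->|wx]]; first exact: ltnW.
by rewrite (depth_par tree wr) wx.
Qed.

Lemma crosses_incident x w y : crosses x w y -> incident x w /\ incident y w.
Proof.
case=> wr [[wx ->]|[wx ->]]; split; (split; first exact: wr).
- by left.
- by right.
- by right.
- by left.
Qed.

(** A sparse slot holds at most one bar, so a step exchanges its two ends or does nothing, and can
    be undone. *)
Lemma slot_step_inj M K j x x' y : sparse M K -> (j <= K)%N ->
  (depth x < M)%N -> (depth x' < M)%N ->
  slot_step K j x y -> slot_step K j x' y -> x = x'.
Proof.
move=> [sp _] jK xM x'M [[e H]|[w [c r]]] [[e' H']|[w' [c' r']]]; subst.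
- by [].
- by have [_ /H] := crosses_incident c'; rewrite r'.
- by have [_ /H'] := crosses_incident c; rewrite r.
have [i1 _] := crosses_incident c; have [i2 _] := crosses_incident c'.
have [t [Nt tj]] := asboolW r; have [t' [Nt' tj']] := asboolW r'.
have [ww _] := sp _ _ _ _ _ (incident_root i1) (incident_root i2)
  (incident_depth xM i1) (incident_depth x'M i2) jK Nt Nt' tj tj'.
subst w'; have [_ [parne _]] := tree.
case: c c' => wr [[wx yw]|[wx yw]] [_ [[wx' yw']|[wx' yw']]].
- by rewrite -wx -wx'.
- by case: (parne w wr); rewrite -yw.
- by case: (parne w wr); rewrite -yw'.
- by rewrite -wx -wx'.
Qed.

Lemma walk_inj M K n i x x' y : sparse M K ->
  walk M K n i x y -> walk M K n i x' y -> x = x'.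
Proof.
move=> sp; elim: n i x x' => [|n IH] i x x' /=; first by move=> [_ ->] [_ ->].
move=> [xM [z [xz zy]]] [x'M [z' [xz' zy']]].
have zz := IH _ _ _ zy zy'; subst z'.
by apply: slot_step_inj sp _ xM x'M xz xz'; rewrite -ltnS ltn_pmod.
Qed.

Lemma walk_stay M K n j x y : (depth x < M)%N -> (j + n <= K.+1)%N ->
  (forall w i, incident x w -> (j <= i < j + n)%N -> ~~ rings K w i) ->
  walk M K 0 (j + n) x y -> walk M K n j x y.
Proof.
move=> xM; elim: n j => [|n IH] j jn H /=; first by [].
move=> w0; split => //; exists x; split.
  left; split => // w xw; apply: H => //; rewrite modn_small //; lia.
by apply: IH => //; [lia|move=> w i xw ji; apply: H => //; lia].
Qed.

(** The time [t] may precede the boundary [grid K j], provided no incident edge rings in between.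
    After a jump this holds at the end of the slot of the jump, since sparseness allows no other
    ring there. *)
Lemma travel_walk M K t x u j : sparse M K -> travel M t x u -> 0 <= t ->
  (j <= K.+1)%N -> t <= grid K j ->
  (forall w s, incident x w -> t < s -> s <= grid K j -> ~ N w om s) ->
  walk M K (K.+1 - j) j x u.
Proof.
move=> [sp _] tr; elim: tr j => {t x u} [t x xM H|t x w y t' u xM c Nw tt' t'T H tr IH] j t0 jK tj Hj.
  apply: walk_stay => //; first by lia.
  move=> w i xw /andP[ji iK]; apply/asboolP => -[s [Ns /andP[s1 s2]]].
  apply: H xw _ _ Ns.
    by apply: le_lt_trans tj _; apply: le_lt_trans s1; exact: (grid_le T_gt0 K).
  apply: le_trans s2 _; apply: (@le_trans _ _ (grid K K.+1)); last by rewrite gridT.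
  apply: (grid_le T_gt0 K); lia.
have [xw yw] := crosses_incident c.
have jt' : grid K j < t' by rewrite ltNge; apply/negP => /(Hj _ _ xw tt').
have [i iK /andP[it' t'i]] := slot_of K (le_lt_trans t0 tt') t'T.
have ji : (j <= i)%N.
  rewrite leqNgt; apply/negP => ij; have := grid_le T_gt0 K ij; lra.
have -> : (K.+1 - j = (i - j) + (K.+1 - i))%N by lia.
have stay : walk M K (i - j) j x x.
  apply: walk_stay => //; first by lia.
  move=> w' l xw' /andP[jl li]; apply/asboolP => -[s [Ns /andP[s1 s2]]].
  apply: H xw' _ _ Ns.
    by apply: le_lt_trans tj _; apply: le_lt_trans s1; exact: (grid_le T_gt0 K).
  apply: le_lt_trans s2 _; apply: le_lt_trans it'; apply: (grid_le T_gt0 K); lia.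
apply: walk_cat stay _; rewrite subnKC // subSn //=; split => //; exists y; split.
  right; exists w; split => //; rewrite modn_small //.
  by apply: rings_of Nw _; rewrite it' t'i.
have yM : (depth y < M)%N by case: tr => //.
rewrite -subSS; apply: IH => //; first by exact: ltW (le_lt_trans t0 tt').
move=> w' s yw' t's si Ns.
have [_ t'E] := sp _ _ _ _ _ (incident_root xw) (incident_root yw') (incident_depth xM xw)
  (incident_depth yM yw') iK Nw Ns (introT andP (conj it' t'i))
  (introT andP (conj (lt_trans it' t's) si)).
by rewrite t'E ltxx in t's.
Qed.

End Trajectories.

(** * From finite cycles to closed slot walks *)

Section ClosedWalk.
Variables (R : realType) (V : choiceType) (root : V) (par : V -> V).
Hypothesis tree : rooted_tree root par.
Variables (D : nat) (ks : V -> seq V).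
Hypothesis ksP : forall v, [/\ uniq (ks v), (size (ks v) <= D)%N &
             forall w, (w \in ks v) <-> offspring root par v w].
Variables (dm : measure_display) (Omega : measurableType dm).
Variables (N : V -> Omega -> set R) (T : R) (om : Omega).
Hypothesis T_gt0 : 0 < T.
Local Notation depth := (depth tree).
Local Notation grid := (grid T).
Local Notation rings K w j := (rings N T K w j om).
Local Notation travel := (travel tree N T om).
Local Notation walk := (walk tree N T om).
Local Notation sparse := (sparse tree N T om).

Lemma positive_lower_bound (s : seq R) : exists2 e : R, 0 < e & forall x, x \in s -> 0 < x -> e <= x.
Proof.
elim: s => [|x s [e e0 es]]; first by exists 1.
case: (ltrP 0 x) => x0; last first.
  by exists e => // y; rewrite in_cons => /orP[/eqP -> /lt_geF|/es //]; rewrite x0.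
exists (Num.min e x); first by rewrite lt_min e0 x0.
move=> y; rewrite in_cons ge_min => /orP[/eqP -> _|/es ys /ys ->//].
by rewrite lexx orbT.
Qed.

Lemma mesh_small (e : R) : 0 < e -> exists K0, forall K, (K0 <= K)%N -> T / K.+1%:R < e.
Proof.
move=> e0; exists (Num.truncn (T / e)) => K KK.
rewrite ltr_pdivrMr // mulrC -ltr_pdivrMr //; apply: lt_le_trans (truncnS_gt _) _.
by rewrite ler_nat.
Qed.

(** The ball has finitely many rings up to [T]; a mesh below the least positive distance between
    them separates them. Time 0 is added to the list to keep the first slot empty. *)
Lemma sparse_eventually M :
  (forall w, w <> root -> finite_set (N w om `&` [set t | 0 < t /\ t <= T])) ->
  (forall w w' (t : R), w <> root -> w' <> root -> 0 < t -> t <= T ->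
     N w om t -> N w' om t -> w = w') ->
  exists K0, forall K, (K0 <= K)%N -> sparse M K.
Proof.
move=> fin simul.
have [s sP] : exists s : seq R, forall w t, w \in tree_ball root ks M ->
    N w om t -> 0 < t -> t <= T -> t \in s.
  have : forall w, w \in tree_ball root ks M -> w <> root.
    by move=> w; rewrite (mem_tree_ball tree ksP) => wM wr; rewrite wr depth_root in wM.
  elim: (tree_ball root ks M) => [|w l IH] lr; first by exists [::].
  have [|s sP] := IH; first by move=> w' w'l; apply: lr; rewrite in_cons w'l orbT.
  have /finite_seqP[s' s'P] := fin w (lr w (mem_head _ _)).
  exists (s' ++ s) => w' t; rewrite in_cons mem_cat => /orP[/eqP ->|w'l] Nt t0 tT.
    have : (N w om `&` [set t | 0 < t /\ t <= T]) t by [].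
    by rewrite s'P /= => ->.
  by rewrite (sP w' t) ?orbT.
have [e e0 eP] := positive_lower_bound [seq `|a - b| | a <- 0 :: s, b <- 0 :: s].
have gap a b : a \in 0 :: s -> b \in 0 :: s -> `|a - b| < e -> a = b.
  move=> as_ bs; apply: contraTeq => ab; rewrite -leNgt; apply: eP.
    exact: allpairs_f.
  by rewrite normr_gt0 subr_eq0.
have [K0 K0P] := mesh_small e0; exists K0 => K /K0P Ke.
have inball w : w <> root -> (depth w <= M)%N -> w \in tree_ball root ks M.
  by move=> wr wM; rewrite (mem_tree_ball tree ksP) wM depth_gt0.
split=> [w w' t t' j wr w'r wM w'M jK Nt Nt' /andP[t1 t2] /andP[t1' t2']|w t wr wM Nt t0].
  have g0 : 0 <= grid K j by rewrite -(grid0 T K); apply: grid_le.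
  have gT : grid K j.+1 <= T.
    by apply: le_trans (grid_le T_gt0 K (jK : (j.+1 <= K.+1)%N)) _; rewrite gridT.
  have gS := gridS T K j.
  have ts : t \in s by exact: (sP w t (inball _ wr wM) Nt (le_lt_trans g0 t1) (le_trans t2 gT)).
  have ts' : t' \in s by exact: (sP w' t' (inball _ w'r w'M) Nt' (le_lt_trans g0 t1') (le_trans t2' gT)).
  have tt' : t = t'.
    apply: gap; rewrite ?in_cons ?ts ?ts' ?orbT //.
    rewrite -gS in Ke; by rewrite ltr_norml; apply/andP; split; lra.
  split => //; subst t'; exact: (simul _ _ t wr w'r (le_lt_trans g0 t1) (le_trans t2 gT)).
have g1 : grid K 1 = T / K.+1%:R by have := gridS T K 0; rewrite grid0 subr0.
case: (lerP t T) => tT; last first.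
  by apply: le_lt_trans (grid_le T_gt0 K (isT : (1 <= K.+1)%N)) _; rewrite gridT.
rewrite ltNge g1; apply/negP => tK.
have : t = 0.
  apply: gap; rewrite ?in_cons ?eqxx //.
    by rewrite (sP w) ?orbT //; exact: inball.
  by rewrite subr0 gtr0_norm //; exact: le_lt_trans tK Ke.
by move=> t00; rewrite t00 ltxx in t0.
Qed.

(** A finite range forces [u a = u b] for some [a < b]. Walking back [a] rounds from this vertex
    leads both to [u 0] and to [u (b - a)], which agree because slot walks are injective; so [b - a]
    rounds close up at the start. *)
Lemma closed_walk (u : nat -> V) :
  (forall n, exists M, travel M 0 (u n) (u n.+1)) ->
  finite_set (range u) ->
  exists J M, [/\ (0 < J)%N & forall K, sparse M K -> walk M K (J * K.+1) 0 (u 0%N) (u 0%N)].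
Proof.
move=> /choice[Mf trav] fin_u.
have [a [b [ab uab]]] : exists a b, (a < b)%N /\ u a = u b.
  apply: contrapT => inj; apply: infinite_nat.
  have u_inj : injective u.
    move=> a b uab; have [ab|ab|//] := ltngtP a b; exfalso; apply: inj.
      by exists a, b.
    by exists b, a.
  rewrite -(_ : u @^-1` (range u) = setT); last by apply/seteqP; split => // n _; exists n.
  by apply: finite_preimage fin_u => x y _ _; exact: u_inj.
pose M := (\max_(n < b) Mf n)%N; exists (b - a)%N, M; split; first by rewrite subn_gt0.
move=> K sp.
have step n : (n < b)%N -> walk M K K.+1 0 (u n) (u n.+1).
  move=> nb; have trn : travel M 0 (u n) (u n.+1).
    apply: travel_leq (trav n); exact: (leq_bigmax (Ordinal nb)).
  have := travel_walk T_gt0 sp trn (lexx 0) (leq0n K.+1); rewrite subn0 grid0; apply => //.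
  by move=> w s _ s1 s2; have := lt_le_trans s1 s2; rewrite ltxx.
have steps c n : (c + n <= b)%N -> (0 < b)%N -> walk M K (n * K.+1) 0 (u c) (u (c + n)%N).
  elim: n => [|n IH] cn b0.
    rewrite mul0n addn0; split => //.
    have [cb|cb] := ltnP c b; first exact: walk_depth (step c cb).
    have -> : c = b by lia.
    by rewrite -uab; exact: walk_depth (step a ab).
  have cn' : (c + n <= b)%N by lia.
  rewrite mulSnr [(c + n.+1)%N]addnS; apply: (walk_cat (IH cn' b0)).
  by rewrite add0n -[X in walk _ _ _ X]add0n; apply: walk_shifts; apply: step; lia.
have b0 : (0 < b)%N by lia.
have w1 := steps 0%N a (ltnW ab) b0.
have w2 := steps (b - a)%N a (eq_leq (subnK (ltnW ab))) b0.
rewrite (subnK (ltnW ab)) -uab in w2.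
have E := walk_inj sp w1 w2.
by have := steps 0%N (b - a)%N (leq_subr _ _) b0; rewrite add0n -E.
Qed.

Section Return.
Variables (M M' K : nat) (v : seq_sub (tree_ball root ks M')).
Hypotheses (MM' : (M <= M')%N) (sp : sparse M K).
Local Notation W := (seq_sub (tree_ball root ks M')).
Local Notation pW := (@parW V root par ks M').
Local Notation dW := (@depW V root par tree ks M').
Local Notation desc := (desc pW dW).
Local Notation kids := (kids pW dW).
Let a := bits N T (fun w : W => val w) K om.
Let a' := set_bit (v, ord0) a.
Local Notation ret := (ret pW dW).
Local Notation sl i := (inZp i : 'I_K.+1).

Lemma ordS_inZp i : ordS (sl i) = sl i.+1.
Proof. by apply: val_inj => /=; rewrite -addn1 modnDml addn1. Qed.

Lemma rings_uniq x w w' j : (depth x < M)%N -> (j <= K)%N ->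
  incident root par x w -> incident root par x w' -> rings K w j -> rings K w' j -> w = w'.
Proof.
move=> xM jK xw xw' /asboolW[t [Nt tj]] /asboolW[t' [Nt' tj']].
have [H _] := sp.
by have [] := H _ _ _ _ _ (incident_root xw) (incident_root xw') (incident_depth xM xw)
  (incident_depth xM xw') jK Nt Nt' tj tj'.
Qed.

(** If the true walk ends on the pole of [v] in slot 0, the recursive walk must answer: below [v] it
    leaves [x] for its parent, where a strictly shorter true walk remains; at [v] the artificial bar
    stops it at the latest. Strong induction is used since an excursion may consume any number of
    steps. *)
Lemma ret_of_walk n i (x : W) : desc v x -> ((i + n) %% K.+1 = 0)%N ->
  walk M K n i (val x) (val v) ->
  exists y, ret a' n.+1 x (sl i) = Some y /\
    (x = v \/ exists n' i', [/\ (n' < n)%N, (i' + n' = i + n)%N, sl i' = ordS y &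
                              walk M K n' i' (par (val x)) (val v)]).
Proof.
elim/ltn_ind: n i x => n IH i x vx iK wlk; rewrite retS.
have jK : (i %% K.+1 <= K)%N by rewrite -ltnS ltn_pmod.
have xM := walk_depth wlk.
have xr : val x <> root by exact: (val_root tree ksP).
have ax : incident root par (val x) (val x) by split => //; left.
have aE (w : W) : a (w, sl i) = rings K (val w) (i %% K.+1) by rewrite ffunE.
case: n IH iK wlk => [|n] IH iK.
  case=> _ /val_inj xv; subst x; exists (sl i); split; last by left.
  rewrite ffunE; have -> : sl i = ord0 by apply: val_inj => /=; rewrite -iK addn0.
  by rewrite eqxx.
case=> _ [z [xz zv]]; have [ax'|nax'] := boolP (a' (x, sl i)).
  exists (sl i); split => //; have [->|xv] := eqVneq x v; first by left.
  right; exists n, i.+1; split => //; first by rewrite addSnnS.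
    by rewrite ordS_inZp.
  have rx : rings K (val x) (i %% K.+1).
    by rewrite -aE; move: ax'; rewrite ffunE xpair_eqE (negbTE xv).
  case: xz => [[_ /(_ _ ax)]|[w [c rw]]]; first by rewrite rx.
  have [xw _] := crosses_incident c.
  have wx := rings_uniq xM jK xw ax rw rx; subst w.
  case: c => _ [[_ zE]|[px _]]; first by rewrite -zE.
  by have [_ [pne _]] := tree; case: (pne _ xr).
have nax : ~~ a (x, sl i).
  by move: nax'; rewrite ffunE negb_or => /andP[].
have kidE c : c \in kids x -> a' (c, sl i) = rings K (val c) (i %% K.+1).
  move=> cx; rewrite -aE ffunE xpair_eqE; case: eqP => [cv|_] //=.
  by case/andP: vx; rewrite -cv (dep_kid cx) ltnn.
have kid_incident c : c \in kids x -> incident root par (val x) (val c).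
  by move=> /(kidsP tree ksP)[cr pc]; split => //; right.
case: xz => [[zx H]|[w [c rw]]].
  have -> : kidbits pW dW a' x (sl i) == finset.set0.
    apply/eqP/setP => c; rewrite finset.in_set finset.in_set0; case cx: (c \in kids x) => //=.
    by rewrite kidE //; apply/negbTE/H; exact: kid_incident.
  rewrite zx in zv; rewrite ordS_inZp.
  have [|y [ry Hy]] := IH n (ltnSn n) i.+1 x vx _ zv; first by rewrite addSnnS.
  exists y; split => //; case: Hy => [->|[n' [i' [n'n E s' w']]]]; [by left|right].
  by exists n', i'; split => //; [exact: ltnW|rewrite E addSnnS].
have [xw _] := crosses_incident c.
case: c => wr [[wx _]|[pw zw]].
  by move: nax; rewrite aE -wx rw.
have wball : w \in tree_ball root ks M'.
  by rewrite (mem_tree_ball tree ksP) (depth_par tree wr) pw /= (leq_trans xM MM').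
pose c : W := Sub w wball.
have cx : c \in kids x by apply/(kidsP tree ksP); split.
have vc : desc v c by exact: kid_desc cx vx.
have kb : kidbits pW dW a' x (sl i) = [set c]%SET.
  apply/setP => c'; rewrite finset.in_set finset.in_set1; case c'x: (c' \in kids x) => /=; last first.
    by apply/esym/negbTE; apply: contraFN c'x => /eqP ->.
  rewrite kidE //; apply/idP/eqP => [rc'|->]; last exact: rw.
  by apply: val_inj; exact: rings_uniq xM jK (kid_incident _ c'x) xw rc' rw.
have -> : (kidbits pW dW a' x (sl i) == finset.set0) = false.
  by rewrite kb; apply/negbTE/finset.set0Pn; exists c; rewrite finset.in_set1.
have -> : [pick c' | kidbits pW dW a' x (sl i) == [set c']%SET] = Some c.
  case: pickP => [c' /eqP|/(_ c)]; rewrite kb ?eqxx // => /setP/(_ c).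
  by rewrite !finset.in_set1 eqxx => /esym/eqP ->.
rewrite zw in zv; rewrite ordS_inZp.
have [|y [ry Hy]] := IH n (ltnSn n) i.+1 c vc _ zv; first by rewrite addSnnS.
(* The first use of the induction hypothesis covered the excursion to [c]; the second covers the
   rest of the walk, back on the pole of [x]. *)
rewrite ry; case: Hy => [cv|[n' [i' [n'n E s' w']]]].
  by case/andP: vx; rewrite -cv (dep_kid cx) ltnn.
rewrite /= pw in w'; rewrite -s'.
have [|y2 [ry2 Hy2]] := IH n' (leqW n'n) i' x vx _ w'; first by rewrite E addSnnS.
exists y2; split; first exact: (ret_leq (leqW n'n) ry2).
case: Hy2 => [->|[n2 [i2 [n2n' E2 s2 w2]]]]; [by left|right].
by exists n2, i2; split => //; [exact: leq_trans n2n' (leqW (ltnW n'n))|rewrite E2 E addSnnS].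
Qed.

Lemma comes_back_of_walk J n : (0 < J)%N -> (J * K.+1 <= n)%N ->
  walk M K (J * K.+1) 0 (val v) (val v) -> comes_back pW dW n ord0 v a.
Proof.
move=> J0 Jn; have -> : (J * K.+1 = (J * K.+1).-1.+1)%N by rewrite prednK // muln_gt0 J0.
case=> vM [z [vz zv]].
(* Slot 0 has no ring, so the first step stays at [v], and the recursive walk may start in slot
   1. *)
have zE : z = val v.
  case: vz => [[]//|[w [c /asboolW[t [Nt /andP[t1 t2]]]]]].
  have [vw _] := crosses_incident c; have [_ sp2] := sp.
  have := sp2 w t (incident_root vw) (incident_depth vM vw) Nt.
  rewrite mod0n grid0 in t1 t2; move=> /(_ t1).
  by move=> /lt_le_trans/(_ t2); rewrite ltxx.
rewrite zE in zv.
have mod0 : ((1 + (J * K.+1).-1) %% K.+1 = 0)%N.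
  by rewrite add1n prednK ?muln_gt0 ?J0 // modnMl.
have [y [ry _]] := ret_of_walk (desc_refl _ _ v) mod0 zv.
rewrite /comes_back -/a -/a' (_ : ordS ord0 = sl 1); last by apply: val_inj.
rewrite (ret_leq _ ry) //; rewrite prednK ?muln_gt0 ?J0 //.
Qed.

End Return.
End ClosedWalk.

(** * Almost sure regularity of the trajectories *)

Lemma sum_bin n m : (\sum_(i < n) 'C(i, m) = 'C(n, m.+1))%N.
Proof.
elim: n => [|n IH]; first by rewrite big_ord0 bin0n.
by rewrite big_ord_recr /= IH binS addnC.
Qed.

Lemma bin_fact_le n m : ('C(n, m) * m`! <= n ^ m)%N.
Proof.
rewrite bin_ffact; elim: m => [|m IH]; first by rewrite ffactn0.
by rewrite ffactnSr expnSr leq_mul // leq_subr.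
Qed.

Lemma expr_fact_small (R : realType) (c e : R) : 0 < e -> exists m, c ^+ m / m`!%:R < e.
Proof.
move=> e0; have := @cvg_exp_coeff R c.
move=> /cvgrPdist_lt/(_ e e0)[m _ /(_ m (leqnn m))]; rewrite sub0r normrN => H.
by exists m; exact: le_lt_trans (ler_norm _) H.
Qed.

Section SlotRuns.
Variables (R : realFieldType) (W : finType) (K : nat) (p : R).
Hypotheses (p_ge0 : 0 <= p) (p_le1 : p <= 1).
Local Notation env := {ffun W * 'I_K.+1 -> bool}.

Fixpoint slot_runs (l : seq W) (j : nat) (a : env) : bool :=
  if l is w :: l then
    [exists i : 'I_K.+1, (j <= i)%N && (a (w, i) && slot_runs l i.+1 a)]
  else true.

Lemma depon_slot_runs l j : depon (fun i : W * 'I_K.+1 => j <= i.2)%N (slot_runs l j).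
Proof.
elim: l j => [//|w l IH] j /=; apply: depon_exists => i.
case: (leqP j i) => //= ji; apply: depon_and.
  by apply: depon_sub (@depon_bit _ _) => ? /eqP ->.
by apply: depon_sub (IH _) => t; apply: leq_trans; exact: leqW.
Qed.

(** A union bound over increasing sequences of slots; summing over the first slot is the
    hockey-stick identity [sum_bin]. *)
Lemma Pr_slot_runs l j : (j <= K.+1)%N ->
  Pr p (slot_runs l j) <= 'C(K.+1 - j, size l)%:R * p ^+ size l.
Proof.
elim: l j => [|w l IH] j jK /=; first by rewrite bin0 mulr1 Pr_le1.
apply: le_trans (Pr_exists p_ge0 p_le1 _ _) _.
apply: (@le_trans _ _ (\sum_(i < K.+1 | (j <= i)%N)
    'C(K.+1 - i.+1, size l)%:R * p ^+ (size l).+1)).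
  apply: ler_sum => i ji; rewrite (Pr_indep p (@depon_bit _ (w, i))).
    by rewrite Pr_bit exprS mulrCA ler_wpM2l // IH.
  apply: depon_sub (@depon_slot_runs _ _) => t ti.
  by apply: contraTneq ti => -> /=; rewrite ltnn.
rewrite -mulr_suml ler_wpM2r ?exprn_ge0 // -natr_sum ler_nat -sum_bin.
rewrite (reindex_inj rev_ord_inj) /=.
rewrite (big_ord_widen K.+1 (fun i => 'C(i, size l))) ?leq_subr //.
rewrite leq_eqVlt; apply/orP; left; apply/eqP; apply: eq_big => i.
  by have := ltn_ord i; lia.
by move=> _; congr 'C(_, _); have := ltn_ord i; lia.
Qed.

End SlotRuns.

Section AlmostSure.
Variables (R : realType) (dm : measure_display) (Omega : measurableType dm).
Variables (P : probability Omega R) (V : choiceType) (root : V) (par : V -> V).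
Variables (N : V -> Omega -> set R) (T : R).
Hypotheses (T_gt0 : 0 < T) (poissonN : indep_poisson_family P root N).
Hypothesis tree : rooted_tree root par.
Variables (D : nat) (ks : V -> seq V).
Hypothesis ksP : forall v, [/\ uniq (ks v), (size (ks v) <= D)%N &
             forall w, (w \in ks v) <-> offspring root par v w].
Local Notation grid := (grid T).
Local Notation pbit := (pbit T).

Fixpoint runs (l : seq V) (t : R) (om : Omega) : Prop :=
  if l is w :: l then exists t', [/\ t < t', t' <= T, N w om t' & runs l t' om] else True.

Lemma pbit_le K : pbit K <= T / K.+1%:R.
Proof.
rewrite /pbit lerBlDr -lerBlDl; apply: le_trans (expR_ge1Dx _).
by rewrite lexx.
Qed.

Lemma outer_leS (S S' : set Omega) x : S `<=` S' -> outer_le P S' x -> outer_le P S x.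
Proof. by move=> SS [U [mU SU PU]]; exists U; split => //; exact: subset_trans SU. Qed.

(** Once the mesh is below every gap between consecutive rings, these fall in different slots. The
    condition [grid K j < t + e] lets slot [j] start slightly after [t], as the induction
    requires. *)
Lemma slot_runs_of (W : finType) (es : W -> V) (l : seq W) (t : R) om : 0 <= t ->
  runs (map es l) t om -> exists2 e : R, 0 < e & forall K j, T / K.+1%:R < e ->
    grid K j < t + e -> slot_runs l j (bits N T es K om).
Proof.
elim: l t => [|w l IH] t t0 /=; first by exists 1.
move=> [t' [tt' t'T Nt' /IH[|e e0 eP]]]; first by lra.
exists (Num.min e (t' - t)); first by rewrite lt_min e0 subr_gt0.
move=> K j; rewrite lt_min => /andP[Ke Kt] jt.
have jt' : grid K j < t'.
  apply: lt_le_trans jt _; by rewrite -lerBrDl ge_min lexx orbT.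
have [i iK /andP[it' t'i]] := slot_of K (le_lt_trans t0 tt') t'T.
have ji : (j <= i)%N.
  by rewrite leqNgt; apply/negP => ij; have := grid_le T_gt0 K ij; lra.
apply/existsP; exists (Ordinal (iK : (i < K.+1)%N)); rewrite ji /=; apply/andP; split.
  by rewrite ffunE; apply/asboolP; exists t'; rewrite it' t'i.
by apply: eP => //; rewrite -(gridS T K i) in Ke; lra.
Qed.

(** With [m = size l], the slot version has probability at most ['C(K.+1, m) * p ^+ m], hence at
    most [(K.+1 * p) ^+ m / m!] with [K.+1 * p <= T]. This is uniform in [K]. *)
Lemma outer_le_runs (l : seq V) : (forall w, w \in l -> w <> root) ->
  outer_le P [set om | runs l 0 om] (T ^+ size l / (size l)`!%:R).
Proof.
(* [l] may repeat edges: the finite index type holds its distinct members, and [s] is [l] over that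
   type. *)
move=> lr; pose s : seq (seq_sub l) := pmap insub l.
have sE : map val s = l.
  rewrite (pmap_filter (@insubK _ _ _)); apply/all_filterP/allP => w wl.
  by rewrite /= insubT.
have ss : size s = size l by rewrite -{2}sE size_map.
pose E K := [set om | slot_runs s 0 (bits N T (fun w : seq_sub l => val w) K om)].
apply: (@outer_le_liminf _ _ _ _ _ _ E 0) => [K _|om].
  have [|m Pm] := cube_event T_gt0 poissonN val_inj _ (slot_runs s 0 (K := K)).
    by move=> w; apply: lr; exact: valP.
  split => //; apply: le_trans Pm _; rewrite lee_fin.
  apply: le_trans (Pr_slot_runs (pbit_ge0 T_gt0 K) (pbit_le1 T K) s (leq0n _)) _.
  rewrite subn0 ss ler_pdivlMr ?ltr0n ?fact_gt0 // mulrAC -natrM.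
  have Kp : 0 <= K.+1%:R * pbit K <= T.
    rewrite mulr_ge0 ?pbit_ge0 //= mulrC -ler_pdivlMr //; exact: pbit_le.
  apply: (@le_trans _ _ ((K.+1%:R * pbit K) ^+ size l)); last first.
    by have /andP[k0 kT] := Kp; apply: lerXn2r; rewrite ?nnegrE // ltW.
  rewrite exprMn -natrX ler_wpM2r ?exprn_ge0 ?pbit_ge0 // ler_nat.
  exact: bin_fact_le.
move=> /=; rewrite -{1}sE => /(slot_runs_of (lexx 0))[e e0 eP].
have [K0 K0P] := mesh_small T e0; exists K0 => K KK; apply: eP; first exact: K0P.
by rewrite grid0 add0r.
Qed.

Lemma runs_sorted w om (s : seq R) t m : path <%R t s ->
  (forall x, x \in s -> N w om x /\ x <= T) -> (m <= size s)%N -> runs (nseq m w) t om.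
Proof.
elim: s t m => [|x s IH] t [|m] //= /andP[tx xs] sP ms.
have [Nx xT] := sP x (mem_head _ _); exists x; split => //; apply: IH => // y ys.
by apply: sP; rewrite in_cons ys orbT.
Qed.

(** Infinitely many rings contain increasing chains of every length [m], and [T ^+ m / m!] tends to
    0. *)
Lemma finite_rings w : w <> root ->
  P.-negligible [set om | ~ finite_set (N w om `&` [set t | 0 < t /\ t <= T])].
Proof.
move=> wr; apply: outer_le_negligible => e e0; have [m me] := expr_fact_small T e0.
apply: outer_leW (ltW me) _; rewrite -[m in T ^+ m](size_nseq m w) -[m in m`!](size_nseq m w).
apply: outer_leS (outer_le_runs _); last by move=> w' /nseqP[->].
move=> om /= /(infinite_set_fset m)[B BA mB].
have srt : path <%R 0 (sort <=%R (finmap.enum_fset B)).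
  rewrite (path_sortedE (@lt_trans _ R)); apply/andP; split.
    by apply/allP => x; rewrite mem_sort => /BA[_ []].
  by rewrite lt_sorted_uniq_le sort_uniq finmap.fset_uniq sort_le_sorted.
apply: runs_sorted srt _ _; last by rewrite size_sort.
by move=> x; rewrite mem_sort => /BA[Nx []].
Qed.

(** Simultaneous rings share a slot at every mesh, which has probability at most
    [K.+1 * p ^+ 2 <= T ^+ 2 / K.+1]. *)
Lemma no_simultaneous w w' : w <> root -> w' <> root -> w <> w' ->
  P.-negligible [set om | exists t, [/\ 0 < t, t <= T, N w om t & N w' om t]].
Proof.
move=> wr w'r ww; apply: outer_le_negligible => e e0.
have e0' : 0 < e / T by rewrite divr_gt0.
have [K0 /(_ K0 (leqnn _))] := mesh_small T e0'; set K := K0 => Ke.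
pose es (b : bool) := if b then w else w'.
have es_inj : injective es by case; case=> //= E; case: ww.
have es_root b : es b <> root by case: b.
pose A (a : {ffun bool * 'I_K.+1 -> bool}) :=
  [exists j, true && (a (true, j) && a (false, j))].
have [mA PA] := cube_event T_gt0 poissonN es_inj es_root A.
exists [set om | A (bits N T es K om)]; split => //.
  move=> om [t [t0 tT Nt Nt']]; have [j jK tj] := slot_of K t0 tT.
  apply/existsP; exists (Ordinal (jK : (j < K.+1)%N)); rewrite /= !ffunE /=.
  by apply/andP; split; apply/asboolP; exists t.
apply: le_trans PA _; rewrite lee_fin.
have p0 := pbit_ge0 T_gt0 K; have p1 := pbit_le1 T K.
apply: le_trans (Pr_exists p0 p1 _ _) _.
rewrite (eq_bigr (fun=> pbit K * pbit K)); last first.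
  move=> j _; rewrite (Pr_indep _ (@depon_bit _ (true, j))) ?Pr_bit //.
  by apply: depon_sub (@depon_bit _ _) => i /eqP ->.
rewrite sumr_const card_ord -[_ *+ _]mulr_natl mulrA.
have pK := pbit_le K.
apply: (@le_trans _ _ (T * pbit K)).
  by rewrite ler_wpM2r // mulrC -ler_pdivlMr.
apply: le_trans (ler_wpM2l (ltW T_gt0) pK) _.
by rewrite mulrC -ler_pdivlMr // ltW.
Qed.

Definition inc (x : V) : seq V := if x == root then ks x else x :: ks x.
Definition other (x w : V) : V := if w == x then par x else w.

Lemma mem_inc x w : (w \in inc x) <-> incident root par x w.
Proof.
have [_ _ kE] := ksP x; have [pr [pne _]] := tree; rewrite /inc.
case: eqP => xr.
  rewrite kE; split=> [[wr pw]|[wr [wx|pw]]]; split => //; first by right.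
  by case: wr; rewrite wx.
rewrite in_cons; split=> [/orP[/eqP ->|/kE[wr pw]]|[wr [->|pw]]].
- by split => //; left.
- by split => //; right.
- by rewrite eqxx.
- by apply/orP; right; apply/kE.
Qed.

Lemma size_inc x : (size (inc x) <= D.+1)%N.
Proof. by have [_ s _] := ksP x; rewrite /inc; case: ifP => _ //=; exact: leqW. Qed.

Lemma crosses_other x w : incident root par x w -> crosses root par x w (other x w).
Proof.
have [_ [pne _]] := tree.
case=> wr [wx|pw]; split => //; rewrite /other.
  by left; rewrite wx eqxx.
by right; case: eqP => // wx; case: (pne w wr); rewrite pw.
Qed.

Fixpoint edge_paths (m : nat) (x : V) : seq (seq V) :=
  if m is m.+1 then
    flatten [seq [seq w :: l | l <- edge_paths m (other x w)] | w <- inc x]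
  else [:: [::]].

Lemma size_edge_paths m x : (size (edge_paths m x) <= D.+1 ^ m)%N.
Proof.
elim: m x => [//|m IH] x /=; rewrite size_flatten /shape -map_comp expnS.
apply: leq_trans (leq_mul (size_inc x) (leqnn _)).
elim: (inc x) => [//|w s IHs] /=; rewrite size_map mulSn.
exact: leq_add (IH _) IHs.
Qed.

Lemma mem_edge_paths m x l : l \in edge_paths m x ->
  size l = m /\ forall w, w \in l -> w <> root.
Proof.
elim: m x l => [|m IH] x l /=; first by rewrite inE => /eqP ->.
move=> /flatten_mapP[w xw /mapP[l' /IH[sl' l'r] ->]]; split; first by rewrite /= sl'.
move=> w'; rewrite in_cons => /orP[/eqP ->|/l'r //].
by have /mem_inc[] := xw.
Qed.

(** There are at most [D.+1 ^ m] edge paths of length [m], and each rings in increasing order with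
    probability at most [T ^+ m / m!]; the product tends to 0. *)
Lemma no_explosion x :
  P.-negligible [set om | forall m, exists2 l, l \in edge_paths m x & runs l 0 om].
Proof.
apply: outer_le_negligible => e e0.
have [m me] := expr_fact_small (D.+1%:R * T) e0; apply: outer_leW (ltW me) _.
have : outer_le P [set om | exists2 l, l \in edge_paths m x & runs l 0 om]
    ((size (edge_paths m x))%:R * (T ^+ m / m`!%:R)).
  apply: outer_le_seq => l /mem_edge_paths[sl lr]; have := outer_le_runs lr; rewrite sl; exact.
move=> H; apply: outer_leS (outer_leW _ H); first by move=> om /= /(_ m).
rewrite mulrA ler_wpM2r ?invr_ge0 ?ler0n // exprMn ler_wpM2r ?exprn_ge0 ?(ltW T_gt0) //.
by rewrite -natrX ler_nat size_edge_paths.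
Qed.

Lemma finite_seq_min (s : seq R) : s != [::] -> exists2 x, x \in s & forall y, y \in s -> x <= y.
Proof.
elim: s => [//|x s IH] _; case: (eqVneq s [::]) => [->|/IH[y ys ymin]].
  by exists x; rewrite ?mem_head // => y; rewrite inE => /eqP ->.
exists (Num.min x y).
  by rewrite /Num.min; case: ifP => _; rewrite in_cons ?eqxx ?ys ?orbT.
by move=> z; rewrite in_cons ge_min => /orP[/eqP ->|/ymin ->]; rewrite ?lexx ?orbT.
Qed.

(** Induction on the length [m] of the runs that are excluded: the particle jumps at the earliest
    later ring of an incident edge, a minimum over a finite set, and one jump fewer remains
    possible. *)
Lemma travel_exists om m (t : R) x : 0 <= t -> t <= T ->
  (forall w, w <> root -> finite_set (N w om `&` [set t | 0 < t /\ t <= T])) ->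
  ~ (exists2 l, l \in edge_paths m x & runs l t om) ->
  exists M u, travel tree N T om M t x u.
Proof.
move=> t0 tT fin; elim: m t x t0 tT => [|m IH] t x t0 tT nr.
  by case: nr; exists [::]; rewrite //= inE.
have [s sP] : exists s : seq R, forall r, r \in s <->
    exists2 w, w \in inc x & [/\ t < r, r <= T & N w om r].
  have : forall w, w \in inc x -> w <> root by move=> w /mem_inc[].
  elim: (inc x) => [|w l IHl] lr.
    by exists [::] => r; split => // -[].
  have [|s sP] := IHl; first by move=> w' w'l; apply: lr; rewrite in_cons w'l orbT.
  have /finite_seqP[s' s'P] := fin w (lr w (mem_head _ _)).
  exists ([seq r <- s' | t < r] ++ s) => r; rewrite mem_cat mem_filter; split.
    case/orP => [/andP[tr rs']|/sP[w' w'l H]]; last by exists w'; rewrite // in_cons w'l orbT.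
    exists w; first exact: mem_head.
    have : [set` s'] r by [].
    by rewrite -s'P => -[Nr [_ rT]].
  case=> w'; rewrite in_cons => /orP[/eqP ->|w'l] [tr rT Nr]; last first.
    by apply/orP; right; apply/sP; exists w'.
  rewrite tr /=; apply/orP; left.
  have : (N w om `&` [set t | 0 < t /\ t <= T]) r by split => //; split => //; exact: le_lt_trans tr.
  by rewrite s'P.
have [s0|s0] := eqVneq s [::].
  exists (depth tree x).+1, x; apply: travel_stay => // w r /mem_inc xw tr rT Nr.
  by have : r \in s by [apply/sP; exists w]; rewrite s0.
have [r /sP[w xw [tr rT Nr]] rmin] := finite_seq_min s0.
have [||[l lP lr]|M [u tru]] := IH r (other x w); [exact: ltW (le_lt_trans t0 tr)|by []| |].
  apply: nr; exists (w :: l) => /=; last by exists r.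
  by apply/flatten_mapP; exists w => //; apply/mapP; exists l.
exists (maxn M (depth tree x).+1), u.
apply: (travel_jump _ (crosses_other (proj1 (mem_inc x w) xw)) Nr tr rT).
- exact: leq_maxr.
- move=> w' q /mem_inc xw' tq qr Nq.
  have : r <= q by apply: rmin; apply/sP; exists w' => //; split => //; exact: le_trans (ltW qr) rT.
  by rewrite leNgt qr.
- by apply: travel_leq tru; exact: leq_maxl.
Qed.

End AlmostSure.

(** * Conclusion: almost surely some cycle is infinite *)

Lemma mesh_le (F : realFieldType) (c x : F) :
  39 * x <= c * x -> 100 * c * x <= 1 -> x <= 50^-1.
Proof. lra. Qed.

(** The margin from 429 to 420 pays for replacing the slot length [x] by the bit probability, which
    is at least [x / (1 + x)] with [x] at most 1/50. *)
Lemma mass_ge (F : realFieldType) (y : F) : 429 <= y * (1 + 50^-1) -> 420 <= y.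
Proof. lra. Qed.

Section InfiniteCycles.
Variables (R : realType) (dm : measure_display) (Omega : measurableType dm).
Variables (P : probability Omega R) (V : choiceType) (root : V) (par : V -> V).
Variables (N : V -> Omega -> set R) (T : R) (d : nat).
Hypotheses (d39 : (39 <= d)%N) (T_large : 429 / d%:R <= T).
Hypotheses (poissonN : indep_poisson_family P root N) (tree : rooted_tree root par).
Hypothesis many_offspring : min_offspring root par d.
Variables (D : nat) (ks : V -> seq V).
Hypothesis ksP : forall v, [/\ uniq (ks v), (size (ks v) <= D)%N &
             forall w, (w \in ks v) <-> offspring root par v w].

Let d_gt0 : 0 < d%:R :> R. Proof. by rewrite ltr0n (leq_trans _ d39). Qed.

Let T_gt0 : 0 < T.
Proof. by apply: lt_le_trans T_large; apply: divr_gt0; [rewrite ltr0n|exact: d_gt0]. Qed.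

Lemma negligible_seq (I : eqType) (s : seq I) (S : I -> set Omega) :
  (forall i, i \in s -> P.-negligible (S i)) ->
  P.-negligible [set om | exists2 i, i \in s & S i om].
Proof.
elim: s => [|i s IH] Ss.
  by apply: negligibleS (negligible_set0 P) => om [].
have h1 := Ss i (mem_head _ _).
have h2 : P.-negligible [set om | exists2 i, i \in s & S i om].
  by apply: IH => j js; apply: Ss; rewrite in_cons js orbT.
apply: negligibleS (negligibleU h1 h2) => om [j].
by rewrite in_cons => /orP[/eqP -> ?|js ?]; [left|right; exists j].
Qed.

Lemma negligible_edges (S : V -> set Omega) :
  (forall w, w <> root -> P.-negligible (S w)) ->
  P.-negligible [set om | exists w, w <> root /\ S w om].
Proof.
move=> HS.
have HM M : P.-negligible [set om | exists2 w, w \in tree_ball root ks M & S w om].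
  apply: negligible_seq => w; rewrite (mem_tree_ball tree ksP) => wM; apply: HS => wr.
  by rewrite wr depth_root in wM.
apply: negligibleS (negligible_bigcup HM) => om [w [wr Sw]].
exists (depth tree w) => //; exists w => //.
by rewrite (mem_tree_ball tree ksP) leqnn depth_gt0.
Qed.

Definition good (om : Omega) :=
  [/\ forall w, w <> root -> finite_set (N w om `&` [set t | 0 < t /\ t <= T]),
      forall w w' (t : R), w <> root -> w' <> root -> 0 < t -> t <= T ->
        N w om t -> N w' om t -> w = w' &
      forall x, exists m, ~ exists2 l, l \in edge_paths root par ks m x & runs N T l 0 om].

Lemma bad_negligible : P.-negligible [set om | ~ good om].
Proof.
pose S1 w := [set om | ~ finite_set (N w om `&` [set t | 0 < t /\ t <= T])].
pose S2 w := [set om | exists w', w' <> root /\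
  (w <> w' /\ exists t, [/\ 0 < t, t <= T, N w om t & N w' om t])].
pose S3 x := [set om | forall m, exists2 l, l \in edge_paths root par ks m x & runs N T l 0 om].
have n1 := negligible_edges (fun w wr => finite_rings T_gt0 poissonN wr : P.-negligible (S1 w)).
have n2 : P.-negligible [set om | exists w, w <> root /\ S2 w om].
  apply: negligible_edges => w wr; apply: negligible_edges => w' w'r.
  have [ww|ww] := pselect (w = w').
    by apply: negligibleS (negligible_set0 P) => om [].
  by apply: negligibleS (no_simultaneous T_gt0 poissonN wr w'r ww) => om [].
have n3 x : P.-negligible (S3 x) by exact: (no_explosion T_gt0 poissonN tree ksP).
have n3' := negligible_edges (fun w _ => n3 w).
apply: negligibleS (negligibleU (negligibleU n1 n2) (negligibleU n3' (n3 root))) => om bad.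
apply: contrapT => nS; apply: bad; split.
- move=> w wr; apply: contrapT => nf; apply: nS; left; left; by exists w.
- move=> w w' t wr w'r t0 tT Nt Nt'; apply: contrapT => ww; apply: nS; left; right.
  by exists w; split => //; exists w'; split => //; split => //; exists t.
- move=> x; apply: contrapT => nm; apply: nS; right.
  have Sx : S3 x om by move=> m; apply: contrapT => nl; apply: nm; exists m.
  have [xr|xr] := pselect (x = root); first by right; rewrite -xr.
  by left; exists x.
Qed.

Lemma pbit_large : exists K0, forall K, (K0 <= K)%N ->
  [/\ 0 < pbit T K, 100 * d%:R * pbit T K <= 1 & 420 <= d%:R * K.+1%:R * pbit T K].
Proof.
have e0 : 0 < (100 * d%:R)^-1 :> R by rewrite invr_gt0 mulr_gt0.
have [K0 K0P] := mesh_small T e0; exists K0 => K /K0P.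
set x := T / K.+1%:R => xe.
have x0 : 0 < x by rewrite divr_gt0.
have xd : 100 * d%:R * x <= 1.
  have c0 : 0 < 100 * d%:R :> R by rewrite mulr_gt0.
  by rewrite mulrC -ler_pdivlMr // mul1r ltW.
have x50 : x <= 50^-1.
  by apply: mesh_le xd; rewrite ler_wpM2r ?ler_nat // ltW.
have q0 : 0 <= expR (- x) by exact: expR_ge0.
have qle : expR (- x) * (1 + x) <= 1.
  rewrite expRN mulrC ler_pdivrMr ?expR_gt0 // mul1r; exact: expR_ge1Dx.
have pE : pbit T K = 1 - expR (- x) by [].
split.
- by rewrite pE subr_gt0 -expR0 ltr_expR oppr_lt0.
- apply: le_trans xd; rewrite ler_wpM2l ?mulr_ge0 ?ler0n //; exact: pbit_le.
rewrite pE -mulrA.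
have dT : 429 <= d%:R * (K.+1%:R * x).
  by rewrite /x [K.+1%:R * _]mulrC divfK ?pnatr_eq0 // mulrC -ler_pdivrMr.
have px : x <= (1 - expR (- x)) * (1 + x) by rewrite mulrBl mul1r lerBrDr addrC lerD2r.
have p0 : 0 <= 1 - expR (- x) by rewrite subr_ge0 -expR0 ler_expR oppr_le0 ltW.
have K1 : 0 <= d%:R * K.+1%:R :> R by rewrite mulr_ge0 ?ler0n.
apply: mass_ge; apply: le_trans dT _.
rewrite [leLHS]mulrA [X in X * (1 + _)]mulrA -[leRHS]mulrA; apply: ler_wpM2l => //.
by apply: le_trans px _; rewrite ler_wpM2l // lerD2l.
Qed.

Lemma good_returns om v : good om ->
  finite_set [set u | exists n, iter_rel (stir root par (fun w => N w om) T) n v u] ->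
  exists J M K0, [/\ (0 < J)%N & forall K, (K0 <= K)%N ->
    sparse tree N T om M K /\ walk tree N T om M K (J * K.+1) 0 v v].
Proof.
move=> [fin simul expl] fo.
have : forall x, exists y, exists M, travel tree N T om M 0 x y.
  move=> x; have [m /(travel_exists tree ksP (lexx 0) (ltW T_gt0) fin)[M [u tr]]] := expl x.
  by exists u, M.
move=> /choice[nxt tr]; pose u n := iter n nxt v.
have orb n : iter_rel (stir root par (fun w => N w om) T) n v (u n).
  elim: n => [//|n IH]; exists (u n); split => //.
  by have [M tM] := tr (u n); exact: travel_stir T_gt0 _ _ _ tM.
have fu : finite_set (range u).
  by apply: sub_finite_set fo => _ [n _ <-]; exists n.
have [J [M [J0 wlk]]] := closed_walk T_gt0 (fun n => tr (u n)) fu.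
have [K0 K0P] := sparse_eventually tree ksP T_gt0 M fin simul.
by exists J, M, K0; split => // K /K0P sp; split => //; exact: wlk.
Qed.

(** If all cycles are finite, then for large [K] the walks from all [2 ^ m] vertices on level [m] of
    a binary subtree come back. For each large [K] this has probability at most 1/2 to the power
    [2 ^ m], and [outer_le_liminf] passes to the limit. *)
Lemma no_cycle_outer (m : nat) : (0 < m)%N ->
  outer_le P [set om | good om /\
     ~ has_infinite_cycle (stir root par (fun w => N w om) T)] (2^-1 ^+ (2 ^ m)).
Proof.
move=> m0.
have [g [gd g_inj]] := binary_words tree (leq_trans (isT : (1 < 39)%N) d39) many_offspring.
have [K0 K0P] := pbit_large.
(* [K] also bounds the number of rounds: [K * K.+1] steps from level [m] need children only above
   this depth. *)
pose M' K := (m + K * K.+1)%N.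
have gball K (b : m.-tuple bool) : g b \in tree_ball root ks (M' K).
  by rewrite (mem_tree_ball tree ksP) gd size_tuple m0 leq_addr.
pose vs K (b : m.-tuple bool) : seq_sub (tree_ball root ks (M' K)) := Sub (g b) (gball K b).
pose A K a := [forall b, comes_back (@parW V root par ks (M' K))
  (@depW V root par tree ks (M' K)) (K * K.+1) (ord0 : 'I_K.+1) (vs K b) a].
pose E K := [set om | A K (bits N T (fun w : seq_sub (tree_ball root ks (M' K)) => val w) K om)].
apply: (@outer_le_liminf _ _ _ _ _ _ E K0) => [K /K0P[p0 p1 p2]|om [gom ncyc]].
  have [|mA PA] := cube_event T_gt0 poissonN val_inj _ (A K).
    by move=> w; exact: (val_root tree ksP).
  split => //; apply: le_trans PA _; rewrite lee_fin.
  have -> : (2 ^ m = #|{: m.-tuple bool}|)%N by rewrite card_tuple card_bool.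
  have kb := fun v vM => card_kids ksP many_offspring (vM : (depW tree v < M' K)%N).
  apply: (Pr_all_come_back d39 p0 p1 p2 kb ord0 (m0 := m)) => //.
  - move=> b b' /(congr1 val) /= gb; apply: val_inj; apply: g_inj gb.
    by rewrite !size_tuple.
  - by move=> b; rewrite /depW /= gd size_tuple.
have fin v : finite_set [set u | exists n, iter_rel (stir root par (fun w => N w om) T) n v u].
  by apply: contrapT => nf; apply: ncyc; exists v.
have /choice[F FP] : forall b : m.-tuple bool, exists F : nat * nat * nat,
    (0 < F.1.1)%N /\ forall K, (F.2 <= K)%N -> sparse tree N T om F.1.2 K /\
      walk tree N T om F.1.2 K (F.1.1 * K.+1) 0 (g b) (g b).
  by move=> b; have [J [M [K1 [J0 H]]]] := good_returns gom (fin (g b)); exists (J, M, K1).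
(* From [j] on, [K] exceeds the mesh threshold, the number of rounds and the depth bound of the
   closed walk of every word. *)
pose j := (\max_b maxn (F b).2 (maxn (F b).1.1 (F b).1.2))%N.
exists j => K jK; apply/forallP => b.
have jb : (maxn (F b).2 (maxn (F b).1.1 (F b).1.2) <= K)%N.
  by apply: leq_trans jK; exact: (leq_bigmax b).
move: jb; rewrite !geq_max => /and3P[F2K F11K F12K].
have [J0 /(_ K F2K)[sp wlk]] := FP b.
apply: (comes_back_of_walk (v := vs K b) ksP _ sp J0 _ wlk).
  by rewrite /M'; apply: leq_trans F12K _; rewrite (leq_trans _ (leq_addl _ _)) // leq_pmulr.
by rewrite leq_mul2r F11K orbT.
Qed.

Lemma ae_infinite_cycle :
  {ae P, forall om, has_infinite_cycle (stir root par (fun w => N w om) T)}.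
Proof.
have nC : P.-negligible [set om | good om /\
     ~ has_infinite_cycle (stir root par (fun w => N w om) T)].
  apply: outer_le_negligible => e e0; pose m := (Num.truncn e^-1).+1.
  apply: outer_leW (no_cycle_outer (ltn0Sn _ : (0 < m)%N)).
  rewrite exprVn -[leRHS]invrK lef_pV2 ?posrE ?invr_gt0 ?exprn_gt0 // -natrX.
  apply: le_trans (ltW (truncnS_gt e^-1)) _; rewrite ler_nat -/m.
  by apply: leq_trans (ltnW (ltn_expl m (ltnSn 1))) (ltnW (ltn_expl _ (ltnSn 1))).
apply: negligibleS (negligibleU bad_negligible nC) => om /= ncyc.
by have [gom|bom] := pselect (good om); [right|left].
Qed.

End InfiniteCycles.

Theorem theorem2 (R : realType) (V : Type) (root : V) (par : V -> V) (d : nat)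
    (dm : measure_display) (Omega : measurableType dm) (P : probability Omega R)
    (N : V -> Omega -> set R) (T : R) :
  (39 <= d)%N ->
  rooted_tree root par ->
  ~ finite_set [set: V] ->
  bounded_degree root par ->
  min_offspring root par d ->
  indep_poisson_family P root N ->
  429 / d%:R <= T ->
  {ae P, forall om, has_infinite_cycle (stir root par (fun w => N w om) T)}.
Proof.
move=> d39 tree _ bdeg moff poissonN T_large.
(* [{classic V}] is [V] with a classical equality test and choice. *)
have [D [ks ksP]] := @offspring_list {classic V} root par bdeg.
exact: (@ae_infinite_cycle _ _ _ _ {classic V} _ _ _ _ _ d39 T_large poissonN tree moff _ _ ksP).
Qed.
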